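(* Fix integers $d\ge1$, $k\ge3$, $s\ge 2$. For each prime power $q$, let $P(\mathbf{x})=\sum_{j=1}^d a_jx_j^s\in\mathbb{F}_q[x_1,\ldots,x_d]$ with $a_j\neq0$ for all $j$, let $\mathcal{V}\subset\mathbb{F}_q^d$ be a regular variety, let $\mathcal{E}\subseteq\mathcal{V}$ and $X\subseteq\mathbb{F}_q$. If $|X||\mathcal{E}|^{2k-2}\gg q^{(d-1)(k-1)+2}$, then \[|X+\Delta_{k,P}(\mathcal{E})|\gg q,\] where $\Delta_{k,P}(\mathcal{E})=\{P(\mathbf{x}^1+\cdots+\mathbf{x}^k):\mathbf{x}^i\in\mathcal{E},\ 1\le i\le k\}$ and $X+Y=\{x+y:x\in X,y\in Y\}$.
   Context: Let $\chi$ be a fixed nontrivial additive character of $\mathbb{F}_q$. For $\mathcal{V}\subseteq\mathbb{F}_q^d$, $\widehat{\mathbf{1}_\mathcal{V}}(\mathbf{m})=q^{-d}\sum_{\mathbf{x}\in\mathbb{F}_q^d}\chi(-\mathbf{m}\cdot\mathbf{x})\mathbf{1}_\mathcal{V}(\mathbf{x})$. A variety $\mathcal{V}=\{\mathbf{x}\in\mathbb{F}_q^d : F(\mathbf{x})=0\}$ ($F$ a polynomial over $\mathbb{F}_q$) is regular if $|\mathcal{V}|\asymp q^{d-1}$ and $|\widehat{\mathbf{1}_\mathcal{V}}(\mathbf{m})|\ll q^{-(d+1)/2}$ for all $\mathbf{m}\neq\mathbf{0}$. Asymptotic conventions: all objects depend on $q$ with $d,k,s$ fixed; $X\asymp Y$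 means $C_1Y<X<C_2Y$, $X\ll Y$ means $X\le CY$, with positive constants independent of $q$ (the conclusion's constant may depend on the hypothesis' constant).
   Formalization: The formal theorem assumes in addition that s is not a power of the characteristic of F_q; otherwise P is a Frobenius power of a linear form and the claim fails (e.g. s=2, q=2^n, d=5, k=3, V: x5=x1x2+x3x4, E the part of V with zero coordinate sum, X={0}). *)

(* Defs.v *)
From HB Require Import structures.
From mathcomp Require Import all_boot all_order all_algebra.
From mathcomp Require Import complex mpoly.
From mathcomp Require Import reals.

Set Implicit Arguments.
Unset Strict Implicit.
Unset Printing Implicit Defensive.

Import Order.TTheory GRing.Theory Num.Theory.

Local Open Scope ring_scope.
Local Open Scope complex_scope.

Definition additive_character (F : finFieldType) (R : realType)
    (chi : F -> R[i]) : Prop :=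
  chi 0 = 1 /\ {morph chi : x y / x + y >-> x * y}.

Definition nontrivial_additive_character (F : finFieldType) (R : realType)
    (chi : F -> R[i]) : Prop :=
  additive_character chi /\ exists x, chi x != 1.

Definition dotv (F : finFieldType) (d : nat) (m x : 'rV[F]_d) : F :=
  \sum_(j < d) m 0 j * x 0 j.

Definition fourier_indicator (F : finFieldType) (R : realType) (d : nat)
    (chi : F -> R[i]) (V : {set 'rV[F]_d}) (m : 'rV[F]_d) : R[i] :=
  #|F|%:R ^- d * \sum_(x : 'rV[F]_d) chi (- dotv m x) * (x \in V)%:R.

Definition peval (F : finFieldType) (d : nat) (P : {mpoly F[d]})
    (x : 'rV[F]_d) : F :=
  P.@[fun j => x 0 j].

Definition variety (F : finFieldType) (d : nat) (f : {mpoly F[d]}) :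
    {set 'rV[F]_d} :=
  [set x | peval f x == 0].

(* [C1], [C2], [C3] are the constants implicit in |V| ~ q^(d-1) and in
   |V^(m)| << q^(-(d+1)/2); the latter power is written (sqrt q)^-(d+1). *)
Definition regular_variety (F : finFieldType) (R : realType) (d : nat)
    (chi : F -> R[i]) (C1 C2 C3 : R) (V : {set 'rV[F]_d}) : Prop :=
  [/\ exists f : {mpoly F[d]}, V = variety f,
      C1 * #|F|%:R ^+ (d - 1) < #|V|%:R < C2 * #|F|%:R ^+ (d - 1)
    & forall m : 'rV[F]_d, m != 0 ->
        `|fourier_indicator chi V m|
          <= (C3 * Num.sqrt #|F|%:R ^- (d + 1))%:C].

Definition diag_poly (F : finFieldType) (d s : nat) (a : 'I_d -> F) :
    {mpoly F[d]} :=
  \sum_(j < d) a j *: 'X_j ^+ s.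

Definition Delta (F : finFieldType) (d k : nat) (P : {mpoly F[d]})
    (E : {set 'rV[F]_d}) : {set F} :=
  [set peval P (\sum_(i < k) x i)
     | x : {ffun 'I_k -> 'rV[F]_d} & [forall i, x i \in E]].

Definition sumset (F : finFieldType) (X Y : {set F}) : {set F} :=
  [set x + y | x in X, y in Y].

(* Main.v *)
Require Import Defs.
From HB Require Import structures.
From mathcomp Require Import all_boot all_order all_algebra all_field.
From mathcomp Require Import complex mpoly.
From mathcomp Require Import reals zify ring lra.

Set Implicit Arguments.
Unset Strict Implicit.
Unset Printing Implicit Defensive.

Import Order.TTheory GRing.Theory Num.Theory.

Local Open Scope ring_scope.
Local Open Scope complex_scope.

(* The heart of the matter is Weil's bound for the exponential sums of
   [psi (a x^s + b x)] with [s] not a power of the characteristic. It is proved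
   in an algebraic closure, where the field of degree [n] over [F] (of
   cardinality [q]) is the set of roots of [X^(q^n) - X]: the sums [S_n] over
   these fields are minus the power sums of the roots of the L-function, a
   polynomial of degree [s - 1], and Stepanov's method gives
   [|S_(2m)| = O(q^m)], whence all the roots have absolute value at most
   [sqrt q].

   For the theorem, let [e(m)] be the sum of [chi(m.x)] over [x] in [E] and [M_n]
   the [n]-th moment of [|e|]. By Weil's bound, the sum of [chi(t P(x1 + ... + xk))]
   over [E^k] is at most [s^d q^(-d/2) M_k] for [t != 0], and
   [M_k^2 <= M_(2i) M_(2j)] for [i + j = k]. Regularity of [V] bounds the even
   moments: [M_(2n) <= 2 |V| |E|^(2n-1) + O(q^(d-1)) M_(2n-2)]. The balanced choice
   of [i] and [j] makes the resulting error terms admissible for every [k >= 3]. *)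

(** * Newton's identities and power sums *)

(** Lists of roots in the closure replace factorization into irreducibles: the Euler product of the
    L-function enters only through its logarithmic derivative [n c_n = sum_j S_j c_(n-j)], obtained
    by writing the degree of a monic polynomial as a number of Frobenius orbits dividing it.
    Stepanov's method works in even degree because it rests on a power [B] with [x^(B B) = x], which
    exchanges two halves of the trace. Even degrees suffice: they control the power sums of the
    squared roots, and constant factors disappear for large exponents. The method bounds the fibres
    of the trace only from above; that the values of [psi] sum to zero turns this into a bound for
    the exponential sum. With [w = q^(d-1)] and [u = |E|^2 / w], the hypothesis reads
    [c q^2 <= |X| u^(k-1)], and [M_(2n+2) = O(w^(n+1) |E| (q + u^n))]. What is needed is
    [(q + u^i)(q + u^j) = O(|X| u^(k-1))] with [i + j + 2 = k]. Bounding the mixed terms [q u^i] and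
    [q u^j] asks for [2i, 2j <= k - 1], hence the balance. *)

Definition recip_prod (A : comNzRingType) (r : seq A) : {poly A} :=
  \prod_(x <- r) (1 - x *: 'X).

Lemma coef_1BZX_mul (A : comNzRingType) (x : A) (p : {poly A}) k :
  ((1 - x *: 'X) * p)`_k = p`_k - x * (if k is k'.+1 then p`_k' else 0).
Proof.
rewrite mulrBl mul1r coefB -scalerAl coefZ [_ * p]mulrC coefMX.
by case: k.
Qed.

(** For [h = recip_prod r], this is the coefficient of degree [k] in
    [- X h' = h * sum_x x X / (1 - x X)]. The reciprocal form of the product makes it valid for
    every [k], even beyond the length of [r]. *)
Lemma newton_identity (A : comNzRingType) (r : seq A) k :
  \sum_(i < k) (recip_prod r)`_i * \sum_(x <- r) x ^+ (k - i)
    = - ((recip_prod r)`_k *+ k).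
Proof.
elim: r k => [|x r IH] k.
  rewrite /recip_prod big_nil big1 => [|i _]; last by rewrite big_nil mulr0.
  by rewrite coef1; case: k => [|k]; rewrite ?mulr0n ?mul0rn oppr0.
have e0 i : (recip_prod (x :: r))`_i = (recip_prod r)`_i
    - x * (if i is j.+1 then (recip_prod r)`_j else 0).
  by rewrite /recip_prod big_cons coef_1BZX_mul.
set h := recip_prod r in e0 IH *.
case: k => [|k]; first by rewrite big_ord0 mulr0n oppr0.
under eq_bigr => i _ do rewrite big_cons mulrDr e0 !mulrBl.
rewrite !big_split /= !sumrN IH.
have -> : \sum_(i < k.+1) h`_i * x ^+ (k.+1 - i)
    - \sum_(i < k.+1) (x * match i : nat with 0 => 0 | j.+1 => h`_j end) *
       x ^+ (k.+1 - i) = x * h`_k.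
  rewrite big_ord_recr big_ord_recl /= mulr0 mul0r add0r subSnn expr1.
  rewrite addrAC [X in X - _ + _](_ : _ = \sum_(i < k)
    x * h`_i * x ^+ (k.+1 - bump 0 i)); first by rewrite subrr add0r mulrC.
  apply: eq_bigr => i _; rewrite /bump leq0n add1n subSS.
  by rewrite subSn ?(ltnW (ltn_ord i))// exprS mulrCA mulrA.
rewrite [X in _ + (_ - X)](_ : _ = x * \sum_(i < k) h`_i * \sum_(y <- r) y ^+ (k - i)).
  by rewrite IH e0 mulrN opprK mulrnBl opprB -mulrnAr [in RHS]mulrSr; 
     rewrite mulrDr mulrnAr addrA [LHS]addrC -!addrA; congr (_ + _); rewrite addrC.
rewrite big_ord_recl /= mulr0 mul0r add0r mulr_sumr.
by apply: eq_bigr => i _; rewrite /bump leq0n add1n subSS mulrA.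
Qed.

Lemma size_recip_prod (A : comNzRingType) (r : seq A) :
  (size (recip_prod r) <= (size r).+1)%N.
Proof.
rewrite /recip_prod; elim: r => [|y r IH]; first by rewrite big_nil size_poly1.
rewrite big_cons; apply/leq_sizeP => j lej; rewrite coef_1BZX_mul.
case: j lej => // j lej; rewrite !nth_default ?mulr0 ?subr0//.
  exact: leq_trans IH _.
by apply: leq_trans IH _; apply: ltnW.
Qed.

Lemma recip_prod_coef (A : comNzRingType) (r : seq A) k : (k <= size r)%N ->
  (recip_prod r)`_k = (\prod_(x <- r) ('X - x%:P))`_(size r - k).
Proof.
rewrite /recip_prod; elim: r k => [|x r IH] k /=.
  by rewrite leqn0 => /eqP->; rewrite !big_nil.
move=> lek; rewrite !big_cons coef_1BZX_mul mulrBl coefB coefXM coefCM.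
case: k lek => [|k] lek.
  rewrite subn0 /= mulr0 subr0 IH// subn0.
  by rewrite [X in _ * X]nth_default ?size_prod_XsubC// mulr0 subr0.
rewrite subSS [X in _ - x * X]IH//; congr (_ - _); move: lek; rewrite ltnS => lek.
case: (ltnP k (size r)) => [ltk|gek].
  by rewrite IH// (_ : size r - k = (size r - k.+1).+1)%N // subnSK.
have -> : k = size r by apply/eqP; rewrite eqn_leq lek.
by rewrite subnn eqxx nth_default // size_recip_prod.
Qed.

(** * Linear dependence and independence of polynomials *)

Lemma poly_dependent (K : fieldType) (I : finType) (D : nat)
    (p : I -> {poly K}) :
  (forall i, (size (p i) <= D)%N) -> (D < #|I|)%N ->
  exists2 mu : I -> K, (exists i, mu i != 0) & \sum_i mu i *: p i = 0.
Proof.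
move=> szp ltDI.
pose M := \matrix_(i < #|I|, j < D) (p (enum_val i))`_j.
have : kermx M != 0.
  by rewrite kermx_eq0 /row_free neq_ltn (leq_ltn_trans (rank_leq_col M)).
move=> /rowV0Pn[v /sub_kermxP vM v0].
exists (fun i => v 0 (enum_rank i)).
  case/rV0Pn: v0 => j vj; exists (enum_val j); by rewrite enum_valK.
apply/polyP => j; rewrite coef0 coef_sum.
case: (ltnP j D) => [ltj|gej]; last first.
  by rewrite big1 // => i _; rewrite coefZ nth_default ?mulr0// (leq_trans (szp i)).
move/rowP: vM => /(_ (Ordinal ltj)); rewrite !mxE => vM.
transitivity (\sum_j0 v 0 j0 * M j0 (Ordinal ltj)); last exact: vM.
rewrite (reindex (@enum_val I I)) /=; last first.
  by apply: onW_bij; apply: enum_val_bij.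
by apply: eq_bigr => i _; rewrite coefZ !mxE enum_valK.
Qed.

(** The leading term of the largest polynomial with a nonzero coefficient cannot cancel. *)
Lemma poly_free_size (K : fieldType) (I : finType) (p : I -> {poly K})
    (mu : I -> K) :
  (forall i, p i != 0) -> injective (fun i => size (p i)) ->
  (exists i, mu i != 0) -> \sum_i mu i *: p i != 0.
Proof.
move=> p0 injp [i0 mui0].
case: (@arg_maxnP _ i0 (fun i => mu i != 0) (fun i => size (p i)) mui0) => i mui maxi.
apply/eqP => /(congr1 (fun q : {poly K} => q`_(size (p i)).-1)); rewrite coef0 coef_sum.
rewrite (bigD1 i)//= big1 ?addr0 => [|j ji].
  by rewrite coefZ => /eqP; rewrite mulf_eq0 (negPf mui) -lead_coefE lead_coef_eq0 (negPf (p0 i)).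
rewrite coefZ; have [->|muj] := eqVneq (mu j) 0; first by rewrite mul0r.
rewrite nth_default ?mulr0//.
have : (size (p j) < size (p i))%N.
  rewrite ltn_neqAle [X in _ && X](maxi j muj) andbT.
  by apply: contra ji => /eqP/injp->.
by move=> h; rewrite -ltnS (leq_trans h)// leqSpred.
Qed.

(** * Absolute values and growth of power sums *)

Lemma bernoulli_ineq (R : numDomainType) (x : R) n : 0 <= x ->
  1 + x *+ n <= (1 + x) ^+ n.
Proof.
move=> x0; elim: n => [|n IH]; first by rewrite mulr0n addr0 expr0.
rewrite exprS; apply: le_trans (_ : (1 + x) * (1 + x *+ n) <= _); last first.
  by rewrite ler_wpM2l// addr_ge0.
rewrite mulrDl mul1r mulrDr mulr1 mulrS addrA -addrA [x + _]addrC addrA lerD2l.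
by rewrite lerDl mulr_ge0// mulrn_wge0.
Qed.

Lemma bounded_expr_le1 (R : realType) (r K : R) (m0 : nat) :
  (forall m, (m0 <= m)%N -> r ^+ m <= K) -> r <= 1.
Proof.
move=> rK; case: leP => // r1.
have r1' : 0 < r - 1 by rewrite subr_gt0.
pose n := Num.bound (K / (r - 1)).
have /(le_trans (bernoulli_ineq n (ltW r1'))) : (1 + (r - 1)) ^+ n <= K.
  have h := rK _ (leq_maxl m0 n).
  rewrite addrC subrK; apply: le_trans h; rewrite ler_weXn2l ?leq_maxr//.
  exact: ltW.
have K0 : 0 <= K by apply: le_trans (rK _ (leqnn _)); rewrite exprn_ge0// (le_trans ler01 (ltW r1)).
have : K / (r - 1) < n%:R by apply: archi_boundP; rewrite divr_ge0 ?(ltW r1').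
rewrite ltr_pdivrMr// mulr_natl => h1 h2.
by have := lt_le_trans h1 (le_trans _ h2); rewrite ltxx lerDr ler01 => /(_ isT).
Qed.

(** The norm of [R[i]] takes its values in [R[i]]; its real part brings estimates into the ordered
    field [R]. *)
Definition cabs (R : realType) (z : R[i]) : R := complex.Re `|z|.

Lemma cabsE (R : realType) (z : R[i]) : `|z| = (cabs z)%:C.
Proof. by rewrite /cabs RRe_real// normr_real. Qed.

Lemma cabs_ge0 (R : realType) (z : R[i]) : 0 <= cabs z.
Proof. by rewrite -ler0c -cabsE normr_ge0. Qed.

Lemma cabsM (R : realType) (z w : R[i]) : cabs (z * w) = cabs z * cabs w.
Proof. by apply: complexI; rewrite rmorphM -!cabsE normrM. Qed.

Lemma cabsX (R : realType) (z : R[i]) n : cabs (z ^+ n) = cabs z ^+ n.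
Proof. by apply: complexI; rewrite rmorphXn -!cabsE normrX. Qed.

Lemma cabsN (R : realType) (z : R[i]) : cabs (- z) = cabs z.
Proof. by rewrite /cabs normrN. Qed.

Lemma cabs_nat (R : realType) n : cabs (n%:R : R[i]) = n%:R.
Proof. by apply: complexI; rewrite rmorph_nat -!cabsE normr_nat. Qed.

Lemma cabs_sum (R : realType) (I : Type) (r : seq I) (P : pred I) (f : I -> R[i]) :
  cabs (\sum_(i <- r | P i) f i) <= \sum_(i <- r | P i) cabs (f i).
Proof.
rewrite -lecR -cabsE rmorph_sum /=.
rewrite [leRHS](eq_bigr (fun i => `|f i|)); last by move=> i _; rewrite cabsE.
exact: ler_norm_sum.
Qed.

(* Pairing the power sums with the coefficients of a polynomial vanishing at
   all the other [y] isolates the contribution of [z]. *)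
Lemma power_sum_growth (R : realType) (zs : seq R[i]) (K rho : R) (m0 : nat) :
  0 < rho ->
  (forall m, (m0 <= m)%N -> cabs (\sum_(z <- zs) z ^+ m) <= K * rho ^+ m) ->
  forall z, z \in zs -> cabs z <= rho.
Proof.
move=> rho0 bnd z zin.
pose P := \prod_(y <- [seq y <- undup zs | y != z]) ('X - y%:P).
have Pz : P.[z] != 0.
  have : ~~ root P z.
    by rewrite root_prod_XsubC mem_filter eqxx.
  by [].
have Py y : y \in zs -> y != z -> P.[y] = 0.
  move=> yin yz; apply/rootP; rewrite root_prod_XsubC mem_filter yz mem_undup//.
have key m : \sum_(l < size P) P`_l * (\sum_(y <- zs) y ^+ (m + l))
    = (count_mem z zs)%:R * z ^+ m * P.[z].
  under eq_bigr => l _ do rewrite mulr_sumr.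
  rewrite exchange_big /= (eq_big_seq (fun y => if y == z then z ^+ m * P.[z] else 0)).
    by rewrite -big_mkcond /= big_const_seq iter_addr addr0 -mulrA mulr_natl; congr (_ *+ _).
  move=> y yin; transitivity (y ^+ m * P.[y]).
    rewrite horner_coef mulr_sumr; apply: eq_bigr => l _.
    by rewrite exprD mulrCA.
  by case: eqP => [->//|/eqP yz]; rewrite Py// mulr0.
have c0 : (count_mem z zs)%:R != 0 :> R[i].
  by rewrite pnatr_eq0 -lt0n -has_count; apply/hasP; exists z => //=.
rewrite -[leRHS]mul1r -ler_pdivrMr//.
pose D := cabs ((count_mem z zs)%:R * P.[z]).
have D0 : 0 < D.
  by rewrite -ltcR -cabsE normr_gt0 mulf_neq0.
apply: (@bounded_expr_le1 _ _ ((\sum_(l < size P) cabs P`_l * (K * rho ^+ l)) / D) m0) => m lem.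
rewrite ler_pdivlMr// expr_div_n mulrAC ler_pdivrMr ?exprn_gt0//.
have -> : cabs z ^+ m * D = cabs ((count_mem z zs)%:R * z ^+ m * P.[z]).
  by rewrite /D !cabsM cabsX mulrCA !mulrA.
rewrite -key; apply: le_trans (cabs_sum _ _ _) _.
rewrite mulr_suml; apply: ler_sum => l _.
rewrite cabsM -!mulrA ler_wpM2l ?cabs_ge0//.
have := bnd (m + l)%N (leq_trans lem (leq_addr _ _)).
by rewrite exprD [X in _ <= _ * X]mulrC.
Qed.

(** * Stepanov's method *)

Lemma pnat_card_finField (F : finFieldType) : [pchar F].-nat #|F|.
Proof.
have [p p_pr chp] := finPcharP F.
rewrite (eq_pnat _ (pcharf_eq chp)).
by have := pprimeChar_pgroup chp; rewrite pgroup.pgroupE cardsT.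
Qed.

Lemma card_finField_natr (F : finFieldType) : #|F|%:R = 0 :> F.
Proof.
have [p p_pr chp] := finPcharP F; apply/eqP; rewrite -(dvdn_pcharf chp).
have := pnat_card_finField F; rewrite (eq_pnat _ (pcharf_eq chp)) => /p_natP[k qk].
have := finNzRing_gt1 F; rewrite qk; case: k {qk} => // k _.
by rewrite expnS dvdn_mulr.
Qed.

Lemma pnat_fmorph_card (F : finFieldType) (L : fieldType)
    (emb : {rmorphism F -> L}) n : [pchar L].-nat (#|F| ^ n)%N.
Proof.
rewrite pnatX (eq_pnat _ (fmorph_pchar emb)).
by rewrite pnat_card_finField.
Qed.

Lemma expr_sum_pchar (A : comNzRingType) N (I : Type) (r : seq I) (P : pred I)
    (f : I -> A) : [pchar A].-nat N ->
  (\sum_(i <- r | P i) f i) ^+ N = \sum_(i <- r | P i) f i ^+ N.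
Proof.
move=> chN; apply: (big_morph (fun x => x ^+ N)) => [x y|].
  exact: exprDn_pchar.
by have /andP[N0 _] := chN; rewrite expr0n gtn_eqF.
Qed.

Lemma coprime_card_finField (F : finFieldType) s :
  s%:R != 0 :> F -> coprime #|F| s.
Proof.
have [p p_pr chp] := finPcharP F => s0.
have := pnat_card_finField F; rewrite (eq_pnat _ (pcharf_eq chp)) => /p_natP[n ->].
by rewrite coprimeXl// prime_coprime// (dvdn_pcharf chp).
Qed.

Definition binomial_poly (A : nzRingType) (a b : A) (s : nat) : {poly A} :=
  a *: 'X^s + b *: 'X.

Lemma size_binomial_poly (K : fieldType) (a b : K) s : a != 0 -> (1 < s)%N ->
  size (binomial_poly a b s) = s.+1.
Proof.
move=> a0 s1; have sa : size (a *: 'X^s) = s.+1 by rewrite size_scale// size_polyXn.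
rewrite /binomial_poly size_polyDl sa //.
by rewrite (leq_ltn_trans (size_scale_leq _ _))// size_polyX.
Qed.

Lemma size_partial_trace (K : fieldType) (f : {poly K}) (s q m : nat) :
  (0 < s)%N -> size f = s.+1 -> (1 < q)%N ->
  size (\sum_(i < m.+1) f ^+ (q ^ i)) = (s * q ^ m).+1.
Proof.
move=> s0 sf q1.
have sX i : size (f ^+ (q ^ i)) = (s * q ^ i).+1.
  have f0 : f != 0 by rewrite -size_poly_eq0 sf.
  have := size_exp f (q ^ i); rewrite sf /= => h.
  by rewrite -[LHS]prednK ?h// lt0n size_poly_eq0 expf_neq0.
elim: m => [|m IH]; first by rewrite big_ord1 expr1 muln1.
rewrite big_ord_recr /= addrC size_polyDl sX ?IH// ltnS ltn_pmul2l// ltn_exp2l//.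
Qed.

Lemma coprime_combination_inj q s i i1 j j1 : coprime q s ->
  (j < q)%N -> (j1 < q)%N -> (q * i + s * j = q * i1 + s * j1)%N -> j = j1.
Proof.
move=> cqs jq j1q; wlog lejj : j j1 i i1 jq j1q / (j <= j1)%N => [W|e].
  by case/orP: (leq_total j j1) => ? e; [apply: W e|apply/esym; apply: (W j1 j i1 i)].
have : (q %| s * (j1 - j))%N.
  have -> : (s * (j1 - j) = q * (i - i1))%N.
    by rewrite !mulnBr; lia.
  exact: dvdn_mulr.
rewrite Gauss_dvdr// => qd; apply/eqP; rewrite eqn_leq lejj -subn_eq0.
by rewrite -[_ == _]negbK -lt0n; apply/negP => /dvdn_leq/(_ qd); lia.
Qed.

Section FrobeniusFixed.
Variables (F : finFieldType) (L : fieldType) (emb : {rmorphism F -> L}).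
Local Notation q := #|F|.

Lemma emb_expq (c : F) n : emb c ^+ (q ^ n) = emb c.
Proof.
elim: n => [|n IH]; first by rewrite expr1.
by rewrite expnSr exprM IH -rmorphXn expf_card.
Qed.

(* Stepanov's method. As [x -> x ^ B] is injective, it suffices that the [B]-th
   power of the auxiliary polynomial vanishes on [T], where it agrees with a
   polynomial of much smaller degree. *)
Lemma stepanov_count (m s : nat) (a b c : F) (T : seq L) :
  (1 < s)%N -> s%:R != 0 :> F -> a != 0 -> (s.+2 <= q ^ m.+1)%N ->
  uniq T ->
  (forall x, x \in T -> x ^+ (q ^ m.+1 * q ^ m.+1) = x) ->
  (forall x, x \in T ->
     let h := \sum_(i < m.+1)
       (map_poly emb (binomial_poly a b s)).[x] ^+ (q ^ i) in
     h + h ^+ (q ^ m.+1) = emb c) ->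
  (size T <= q ^ m * q ^ m.+1 + s.*2.+2 * q ^ m.+1)%N.
Proof.
move=> s1 s0 a0 sB uT TQ Th.
have q1 : (1 < q)%N by apply: finNzRing_gt1.
set f := binomial_poly a b s in Th; set B := (q ^ m.+1)%N in sB TQ Th *.
set b0 := (q ^ m)%N.
have b0_gt0 : (0 < b0)%N by rewrite expn_gt0 ltnW.
have BE : B = (q * b0)%N by rewrite /B expnS.
have sf : size f = s.+1 by apply: size_binomial_poly.
(* This is one half of the trace; the other half is its [B]-th power, so that [h ^+ B = c - h] on
   [T]. *)
pose h := \sum_(i < m.+1) f ^+ (q ^ i).
have sh : size h = (s * b0).+1 by apply: size_partial_trace => //; apply: ltnW.
have h0 : h != 0 by rewrite -size_poly_eq0 sh.
pose ht x := (map_poly emb h).[x].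
have htE x : x \in T -> ht x ^+ B = emb c - ht x.
  move=> /Th /= <-; rewrite /ht /h rmorph_sum /= horner_sum.
  rewrite (eq_bigr (fun i : 'I_m.+1 => (map_poly emb f).[x] ^+ (q ^ i))) => [|i _]; last first.
    by rewrite -horner_exp -rmorphXn.
  by rewrite addrC addKr.
(* As [x ^+ (B * B) = x] on [T], the [B]-th power turns the value of [p k] into that of [r k]. The
   number of indices, [B * (b0 + s.+2)], exceeds the bound on the sizes of the [r k], about
   [B * (b0 + s - 1)], which forces a linear relation between them. *)
pose I := ('I_b0 * 'I_(b0 + s.+2) * 'I_q)%type.
pose r (k : I) := 'X^(k.1.1 * B + k.1.2) * (c%:P - h) ^+ k.2.
pose p (k : I) := 'X^(k.1.1 + B * k.1.2) * h ^+ k.2.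
have sch : (size (c%:P - h)%R <= (s * b0).+1)%N.
  apply: leq_trans (size_polyD _ _) _; rewrite size_polyN sh geq_max leqnn andbT.
  by apply: leq_trans (size_polyC_leq1 _) _.
have szr k : (size (r k) <= b0.-1 * B + (b0 + s.+2) + q.-1 * (s * b0))%N.
  apply: leq_trans (size_polyMleq _ _) _; rewrite size_polyXn addSn /=.
  have hk : (size ((c%:P - h) ^+ k.2)%R <= (k.2 * (s * b0)).+1)%N.
    apply: leq_trans (size_poly_exp_leq _ _) _; rewrite ltnS mulnC leq_mul2l.
    by apply/orP; right; move: sch; case: (size _).
  have k1 : (k.1.1 <= b0.-1)%N by rewrite -ltnS prednK.
  have k3 : (k.2 <= q.-1)%N by rewrite -ltnS prednK// ltnW.
  have k11 := leq_mul k1 (leqnn B).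
  have k31 := leq_mul k3 (leqnn (s * b0)).
  apply: leq_trans (leq_add (leqnn _) hk) _; rewrite addnS -addSn.
  by rewrite leq_add// -addnS leq_add.
have [|mu mu0 rel] := poly_dependent szr.
  rewrite !card_prod !card_ord.
  have e1 : (b0.-1 * B + B = b0 * B)%N by rewrite -mulSnr prednK.
  have e2 : (q.-1 * (s * b0) + s * b0 = s * B)%N.
    by rewrite -mulSnr prednK ?(ltnW q1)// BE mulnCA.
  have e3 : (b0 * (b0 + s.+2) * q = b0 * B + s * B + B + B)%N by rewrite BE; ring.
  have e4 : (b0 <= B)%N by rewrite BE leq_pmull// ltnW.
  have e5 : (0 < s * b0)%N by rewrite muln_gt0 b0_gt0 ltnW.
  lia.
pose G := \sum_k mu k *: p k.
have szp k : size (p k) = (k.1.1 + b0 * (q * k.1.2 + s * k.2)).+1.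
  rewrite /p size_monicM ?monicXn ?expf_neq0// size_polyXn addSn /=.
  have := size_exp h k.2; rewrite sh /= => hk.
  have /prednK <- : (0 < size (h ^+ k.2)%R)%N by rewrite lt0n size_poly_eq0 expf_neq0.
  by rewrite hk BE; ring.
(* The remainder of the degree modulo [b0] gives [k.1.1]; the quotient [q * k.1.2 + s * k.2] gives
   the rest, since [s] is prime to [q] and [k.2 < q]. *)
have injp : injective (fun k => size (p k)).
  move=> [[i i'] j] [[i1 i1'] j1] /=; rewrite !szp /= => -[e].
  have ei : i = i1.
    apply/val_inj; move/(congr1 (modn^~ b0)): e => /=.
    by rewrite ![(b0 * _)%N]mulnC ![(_ + _ * b0)%N]addnC !modnMDl !modn_small.
  move: e; rewrite ei => /addnI /eqP; rewrite eqn_pmul2l// => /eqP e.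
  have ej : j = j1.
    apply/val_inj/(coprime_combination_inj (coprime_card_finField s0) _ _ e).
      exact: ltn_ord.
    exact: ltn_ord.
  move: e; rewrite ej => /addIn /eqP; rewrite eqn_pmul2l ?(ltnW q1)// => /eqP e.
  by rewrite (val_inj e).
have G0 : G != 0.
  apply: poly_free_size => // k; by rewrite -size_poly_eq0 szp.
have GT x : x \in T -> root (map_poly emb G) x.
  move=> xT; have B0 : (0 < B)%N by rewrite BE muln_gt0 b0_gt0 ltnW.
  have chB : [pchar L].-nat B by apply: pnat_fmorph_card.
  have -> : root (map_poly emb G) x = ((map_poly emb G).[x] ^+ B == 0).
    by rewrite expf_eq0 B0.
  rewrite rmorph_sum /= horner_sum expr_sum_pchar//.
  apply/eqP; transitivity (map_poly emb (\sum_k mu k *: r k)).[x]; last first.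
    by rewrite rel rmorph0 horner0.
  rewrite [in RHS]rmorph_sum /= horner_sum; apply: eq_bigr => k _.
  (* The coefficients [mu k] come from [F], hence are fixed by the [B]-th power. *)
  rewrite !map_polyZ !hornerZ exprMn emb_expq; congr (_ * _).
  rewrite !rmorphM /= !rmorphXn /= !map_polyX !hornerM !horner_exp !hornerX.
  rewrite rmorphB /= map_polyC hornerD hornerN hornerC -/(ht x) -htE//.
  rewrite exprMn -!exprM [(B * k.2)%N]mulnC; congr (_ * _).
  by rewrite mulnDl !exprD mulnAC [x ^+ (B * B * _)]exprM TQ.
have GL0 : map_poly emb G != 0 by rewrite map_poly_eq0.
have /(max_poly_roots GL0)/(_ uT) : all (root (map_poly emb G)) T by apply/allP.
rewrite size_map_poly ltnNge => ltTG; rewrite leqNgt; apply: contra ltTG => ltT.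
apply: leq_trans (ltT); apply: leq_trans (size_sum _ _ _) _.
apply/bigmax_leqP => k _; apply: leq_trans (size_scale_leq _ _) _.
rewrite szp ltnS.
have e4 : (b0 <= B)%N by rewrite BE leq_pmull// ltnW.
have h1 := ltn_ord k.1.1; have h2 := ltn_ord k.1.2; have h3 := ltn_ord k.2.
have h2' : (k.1.2 <= b0 + s.+1)%N by rewrite -ltnS -addnS.
have := leq_mul (leqnn B) h2'.
have h4 : (s * b0 * k.2 <= s * b0 * q)%N by rewrite leq_mul2l ltnW ?orbT.
have e5 : (b0 * (q * k.1.2 + s * k.2) = B * k.1.2 + s * b0 * k.2)%N by rewrite BE; ring.
have e6 : (s * b0 * q = s * B)%N by rewrite BE; ring.
have e7 : (B * (b0 + s.+1) = b0 * B + s * B + B)%N by ring.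
have e8 : (s.*2.+2 * B = s * B + s * B + B + B)%N by rewrite -addnn; ring.
rewrite e5 e7 e8 => h5; move: h4; rewrite e6 => h4.
apply: leq_trans (leq_add (ltnW h1) (leq_add h5 h4)) _.
by clear -e4; move: (b0 * B)%N (s * B)%N => u v; lia.
Qed.
End FrobeniusFixed.

(** * Frobenius orbits in an algebraic closure *)

Definition root_seq (L : closedFieldType) (p : {poly L}) : seq L :=
  sval (closed_field_poly_normal p).

Lemma root_seqE (L : closedFieldType) (p : {poly L}) : p \is monic ->
  p = \prod_(z <- root_seq p) ('X - z%:P).
Proof.
rewrite /root_seq => /monicP mp; case: closed_field_poly_normal => r /= {1}->.
by rewrite mp scale1r.
Qed.

Lemma root_seq_prod (L : closedFieldType) (r : seq L) :
  perm_eq (root_seq (\prod_(z <- r) ('X - z%:P))) r.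
Proof. by apply: prod_XsubC_eq; rewrite -root_seqE// monic_prod_XsubC. Qed.

Lemma root_seqM (L : closedFieldType) (p1 p2 : {poly L}) :
  p1 \is monic -> p2 \is monic ->
  perm_eq (root_seq (p1 * p2)) (root_seq p1 ++ root_seq p2).
Proof.
move=> m1 m2; apply: prod_XsubC_eq.
by rewrite big_cat /= -!root_seqE// monicMl.
Qed.

Lemma mem_root_seq (L : closedFieldType) (p : {poly L}) x : p \is monic ->
  (x \in root_seq p) = root p x.
Proof. by move=> mp; rewrite {2}(root_seqE mp) root_prod_XsubC. Qed.

Lemma size_root_seq (L : closedFieldType) (p : {poly L}) : p \is monic ->
  (size (root_seq p)).+1 = size p.
Proof. by move=> mp; rewrite {2}(root_seqE mp) size_prod_XsubC. Qed.

Definition monic_of (K : nzRingType) n (v : 'rV[K]_n) : {poly K} :=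
  'X^n + rVpoly v.

Lemma size_monic_of (K : nzRingType) n (v : 'rV[K]_n) : size (monic_of v) = n.+1.
Proof.
by rewrite /monic_of size_polyDl size_polyXn// ltnS size_poly.
Qed.

Lemma monic_monic_of (K : nzRingType) n (v : 'rV[K]_n) : monic_of v \is monic.
Proof.
rewrite /monic_of monicE lead_coefDl ?lead_coefXn//.
by rewrite size_polyXn ltnS size_poly.
Qed.

Lemma poly_rV_monic_of (K : nzRingType) n : cancel (@monic_of K n)
  (fun p => poly_rV (p - 'X^n)).
Proof. by move=> v; rewrite /monic_of addrC addKr rVpolyK. Qed.

Lemma monic_of_poly_rV (K : nzRingType) n (p : {poly K}) :
  p \is monic -> size p = n.+1 -> monic_of (poly_rV (p - 'X^n) : 'rV_n) = p.
Proof.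
move=> mp sp; rewrite /monic_of poly_rV_K ?[_ + (_ - _)]addrC ?subrK//.
apply/leq_sizeP => j; rewrite leq_eqVlt coefB coefXn => /predU1P[<-|ltj].
  by move/monicP: mp; rewrite lead_coefE sp eqxx => ->; rewrite subrr.
by rewrite gtn_eqF// subr0 nth_default// sp.
Qed.

Section Lfunction.
Variables (F : finFieldType) (L : closedFieldType) (emb : {rmorphism F -> L}).
Local Notation q := #|F|.

Let q_gt1 : (1 < q)%N := finNzRing_gt1 F.
Let q_gt0 : (0 < q)%N := ltnW q_gt1.

Definition emb_inv (y : L) : F := odflt 0 [pick c | emb c == y].

Lemma embK c : emb_inv (emb c) = c.
Proof.
rewrite /emb_inv; case: pickP => [d /eqP/fmorph_inj //|/(_ c)].
by rewrite eqxx.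
Qed.

(** Over [F], ['X^q - 'X] is the product of all the ['X - c%:P], so an element of [L] fixed by the
    [q]-th power is a root of the image of one factor. *)
Lemma emb_invK y : y ^+ q = y -> emb (emb_inv y) = y.
Proof.
move=> yq; suff [c ->] : exists c, y = emb c by rewrite embK.
have /(congr1 (fun p => (map_poly emb p).[y])) := finField_genPoly F.
rewrite rmorphB /= map_polyXn map_polyX hornerD hornerN hornerXn hornerX yq subrr.
rewrite rmorph_prod horner_prod /= => /esym/eqP/prodf_eq0[c _].
rewrite rmorphB /= map_polyX map_polyC hornerXsubC subr_eq0 => /eqP ->.
by exists c.
Qed.

(** The morphism argument witnesses that [L] has the characteristic of [F], on which the additivity
    of the [q]-th power, and so its ring morphism structure, rests. *)
Definition frobq & {rmorphism F -> L} := fun x : L => x ^+ q.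
Local Notation phi := (frobq emb).

Lemma pnat_charL n : [pchar L].-nat (q ^ n)%N.
Proof. exact: pnat_fmorph_card. Qed.

Lemma exprqD n (x y : L) : (x + y) ^+ (q ^ n) = x ^+ (q ^ n) + y ^+ (q ^ n).
Proof. by apply: exprDn_pchar; apply: pnat_charL. Qed.

Lemma exprq_inj n : injective (fun x : L => x ^+ (q ^ n)).
Proof.
move=> x y /= e; apply/eqP; rewrite -subr_eq0.
have qn0 : (0 < q ^ n)%N by rewrite expn_gt0 q_gt0.
suff : (x - y) ^+ (q ^ n) == 0 by rewrite expf_eq0 qn0.
apply/eqP/(addIr (y ^+ (q ^ n))); by rewrite add0r -exprqD subrK.
Qed.

Fact frobq_is_zmod_morphism : zmod_morphism phi.
Proof.
move=> x y; apply/(addIr (y ^+ q)); rewrite /frobq subrK.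
by have := exprqD 1 (x - y) y; rewrite expn1 subrK => <-.
Qed.
Fact frobq_is_monoid_morphism : monoid_morphism phi.
Proof. by split=> [|x y]; rewrite /frobq ?expr1n ?exprMn. Qed.
HB.instance Definition _ :=
  GRing.isZmodMorphism.Build L L phi frobq_is_zmod_morphism.
HB.instance Definition _ :=
  GRing.isMonoidMorphism.Build L L phi frobq_is_monoid_morphism.

Lemma map_frobq_emb (p : {poly F}) :
  map_poly phi (map_poly emb p) = map_poly emb p.
Proof.
by apply/polyP => i; rewrite !coef_map /= /frobq -rmorphXn expf_card.
Qed.

Lemma map_emb_inv (p : {poly L}) : map_poly phi p = p ->
  map_poly emb (map_poly emb_inv p) = p.
Proof.
move=> pP; apply/polyP => i; rewrite coef_map /= coef_map_id0; last first.
  by rewrite -[0](rmorph0 emb) embK.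
by apply: emb_invK; rewrite -[in RHS]pP coef_map.
Qed.

Lemma frobq_prod_XsubC (r : seq L) :
  map_poly phi (\prod_(z <- r) ('X - z%:P)) = \prod_(z <- r) ('X - (z ^+ q)%:P).
Proof.
rewrite rmorph_prod; apply: eq_bigr => z _.
by rewrite rmorphB /= map_polyX map_polyC.
Qed.

(** The length is [j] whatever the period of [x]: when [x ^+ (q ^ j) = x], the repetitions make sums
    over this list traces from the field of degree [j]. *)
Definition frob_orbit j (x : L) : seq L := [seq x ^+ (q ^ i) | i <- iota 0 j].

Definition orbit_poly j (x : L) : {poly L} :=
  \prod_(z <- frob_orbit j x) ('X - z%:P).

(** When [x ^+ (q ^ j) = x], the characteristic polynomial over [F] of [x] in the field of degree
    [j], a power of its minimal polynomial. *)
Definition orbit_polyF j (x : L) : {poly F} :=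
  map_poly emb_inv (orbit_poly j x).

Lemma big_frob_orbit (T : Type) (idx : T) (op : T -> T -> T) j x (g : L -> T) :
  \big[op/idx]_(z <- frob_orbit j x) g z = \big[op/idx]_(i < j) g (x ^+ (q ^ i)).
Proof. by rewrite big_map -[j in LHS]subn0 big_mkord. Qed.

Lemma frob_orbit_shift (T : Type) (idx : T) (op : Monoid.com_law idx) j x (g : L -> T) :
  x ^+ (q ^ j) = x ->
  \big[op/idx]_(z <- frob_orbit j x) g (z ^+ q) = \big[op/idx]_(z <- frob_orbit j x) g z.
Proof.
rewrite !big_frob_orbit; case: j => [|j] xj; first by rewrite !big_ord0.
rewrite big_ord_recr big_ord_recl /= -exprM -expnSr xj expr1 Monoid.mulmC /=.
by congr (op _ _); apply: eq_bigr => i _; rewrite -exprM -expnSr.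
Qed.

Lemma orbit_polyFE j x : x ^+ (q ^ j) = x ->
  map_poly emb (orbit_polyF j x) = orbit_poly j x.
Proof.
move=> xj; apply: map_emb_inv; rewrite frobq_prod_XsubC.
exact: (frob_orbit_shift _ (fun z => 'X - z%:P)).
Qed.

Lemma monic_orbit_poly j x : orbit_poly j x \is monic.
Proof. exact: monic_prod_XsubC. Qed.

Lemma size_orbit_poly j x : size (orbit_poly j x) = j.+1.
Proof. by rewrite size_prod_XsubC size_map size_iota. Qed.

Lemma monic_orbit_polyF j x : x ^+ (q ^ j) = x -> orbit_polyF j x \is monic.
Proof. by move=> xj; rewrite -(map_monic emb) orbit_polyFE// monic_orbit_poly. Qed.

Lemma size_orbit_polyF j x : x ^+ (q ^ j) = x -> size (orbit_polyF j x) = j.+1.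
Proof. by move=> xj; rewrite -(size_map_poly emb) orbit_polyFE// size_orbit_poly. Qed.

Lemma orbit_polyD d j x : x ^+ (q ^ d) = x ->
  orbit_poly (d + j) x = orbit_poly d x * orbit_poly j x.
Proof.
move=> xd; rewrite /orbit_poly !big_frob_orbit big_split_ord /=; congr (_ * _).
by apply: eq_bigr => i _; rewrite expnD exprM xd.
Qed.

(** * The field of degree [n] as a list of roots, and periods of Frobenius *)

Definition froots n : seq L := root_seq ('X^(q ^ n) - 'X).

Let qn_gt1 n : (0 < n)%N -> (1 < q ^ n)%N.
Proof. by move=> n0; rewrite (leq_trans q_gt1)// -{1}(expn1 q) leq_pexp2l. Qed.

Let monic_frob n : (0 < n)%N -> 'X^(q ^ n) - 'X \is @monic L.
Proof.
move=> n0; rewrite monicE lead_coefDl ?lead_coefXn//.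
by rewrite size_polyN size_polyX size_polyXn ltnS qn_gt1.
Qed.

Lemma mem_froots n x : (0 < n)%N -> (x \in froots n) = (x ^+ (q ^ n) == x).
Proof.
move=> n0; rewrite mem_root_seq ?monic_frob// /root.
by rewrite hornerD hornerN hornerXn hornerX subr_eq0.
Qed.

Lemma size_froots n : (0 < n)%N -> size (froots n) = (q ^ n)%N.
Proof.
move=> n0; apply: succn_inj; rewrite size_root_seq ?monic_frob//.
by rewrite size_polyDl size_polyXn// size_polyN size_polyX ltnS qn_gt1.
Qed.

Lemma uniq_froots n : (0 < n)%N -> uniq (froots n).
Proof.
move=> n0; rewrite -separable_prod_XsubC -root_seqE ?monic_frob//.
rewrite unlock derivB derivXn derivX -mulr_natl.
have -> : (q ^ n)%:R = 0 :> {poly L}.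
  apply/eqP; rewrite -polyC_natr polyC_eq0 -(rmorph_nat emb) fmorph_eq0.
  by rewrite natrX card_finField_natr expr0n gtn_eqF.
by rewrite mul0r sub0r -[- 1]scaleN1r coprimepZr ?coprimep1 ?oppr_eq0 ?oner_eq0.
Qed.

Lemma pow_qD (x : L) i j : x ^+ (q ^ (i + j)) = (x ^+ (q ^ i)) ^+ (q ^ j).
Proof. by rewrite expnD exprM. Qed.

(** The [q]-th power preserves the finite set of roots of [g], so the orbit of [x] repeats, and
    injectivity of Frobenius carries the repetition back to [x]. *)
Lemma frob_period (g : {poly F}) x : g != 0 -> root (map_poly emb g) x ->
  exists2 d, (0 < d)%N & x ^+ (q ^ d) = x.
Proof.
move=> g0 gx.
have gxi i : root (map_poly emb g) (x ^+ (q ^ i)).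
  elim: i => [|i IH]; first by rewrite expr1.
  rewrite expnSr exprM -(map_frobq_emb g) /root.
  by rewrite -[_ ^+ q]/(phi _) horner_map (rootP IH) rmorph0.
have pg0 : map_poly emb g != 0 by rewrite map_poly_eq0.
have ar : all (root (map_poly emb g)) (frob_orbit (size g) x).
  by apply/allP => _ /mapP[i _ ->].
have : ~~ uniq (frob_orbit (size g) x).
  apply/negP => u; have := max_poly_roots pg0 ar u.
  by rewrite size_map_poly size_map size_iota ltnn.
case/(uniqPn 0) => i [j [ij]]; rewrite size_map size_iota => js.
rewrite !(nth_map 0%N) ?size_iota ?(ltn_trans ij)// !nth_iota ?(ltn_trans ij)//.
rewrite !add0n => e; exists (j - i)%N; first by rewrite subn_gt0.
by apply: (@exprq_inj i) => /=; rewrite -pow_qD subnK ?(ltnW ij).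
Qed.

Lemma uniq_frob_orbit d x :
  (forall i, (0 < i < d)%N -> x ^+ (q ^ i) != x) -> uniq (frob_orbit d x).
Proof.
move=> dmin; rewrite map_inj_in_uniq ?iota_uniq// => i j.
rewrite !mem_iota !add0n /=.
wlog ij : i j / (i <= j)%N => [W|] id jd e.
  by case/orP: (leq_total i j) => ?; [apply: W|apply/esym; apply: W].
apply/eqP; rewrite eqn_leq ij leqNgt; apply/negP => ltij.
have := dmin (j - i)%N; rewrite subn_gt0 ltij /= => /(_ _)/negP; apply.
  by apply: leq_ltn_trans jd; rewrite leq_subr.
by apply/eqP/(@exprq_inj i) => /=; rewrite -pow_qD subnK.
Qed.

(** If [d] is the least period of [x], the exponents [j.+1] fixing [x] are the multiples [t d], and
    the orbit polynomial of length [t d] is the [t]-th power of the minimal polynomial: it divides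
    [g] exactly for [t] up to the multiplicity of [x]. The induction removes one minimal polynomial
    at a time. *)
Lemma orbit_multiplicity (g : {poly F}) x N : g \is monic ->
  (size g <= N.+1)%N ->
  (\sum_(j < N) ((x ^+ (q ^ j.+1) == x)%R &&
     (orbit_poly j.+1 x %| map_poly emb g)%R) = count_mem x (root_seq (map_poly emb g)))%N.
Proof.
have [n] := ubnP (size g); elim: n g N => // n IH g N sgn mg sgN.
have mgL : map_poly emb g \is monic by rewrite map_monic.
have [gx|ngx] := boolP (root (map_poly emb g) x); last first.
  rewrite (count_memPn _) ?mem_root_seq// big1// => j _.
  case: (boolP (_ %| _)); rewrite ?andbF// => /dvdpP[r gr].
  move: ngx; rewrite gr rootM /orbit_poly big_frob_orbit big_ord_recl /= rootM.
  by rewrite expr1 root_XsubC eqxx orbT.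
have exd : exists d, (0 < d)%N && (x ^+ (q ^ d) == x).
  by have [d d0 xd] := frob_period (monic_neq0 mg) gx; exists d; rewrite d0 xd eqxx.
case: (ex_minnP exd) => d /andP[d0 /eqP xd] dmin.
have dmin' i : (0 < i < d)%N -> x ^+ (q ^ i) != x.
  move=> /andP[i0 id]; apply/negP => xi; have := dmin i; rewrite i0 xi leqNgt id.
  by move/(_ isT).
have ud := uniq_frob_orbit dmin'.
have Pg : orbit_poly d x %| map_poly emb g.
  apply: uniq_roots_dvdp; last by rewrite uniq_rootsE.
  apply/allP => _ /mapP[i _ ->].
  elim: i => [|i IHi]; first by rewrite expr1.
  rewrite expnSr exprM -(map_frobq_emb g) /root.
  by rewrite -[_ ^+ q]/(phi _) horner_map (rootP IHi) rmorph0.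
have [g1 gE] : exists g1 : {poly F}, g = g1 * orbit_polyF d x.
  by apply/dvdpP; rewrite -(dvdp_map emb) orbit_polyFE.
have mPF := monic_orbit_polyF xd.
have mg1 : g1 \is monic by move: mg; rewrite gE monicMr.
have sg : size g = (d + size g1)%N.
  by rewrite gE size_Mmonic ?monic_neq0// size_orbit_polyF// addnS addnC.
have [N' NE] : exists N', N = (d + N')%N.
  exists (N - d)%N; rewrite subnKC//.
  have : (0 < size g1)%N by rewrite lt0n size_poly_eq0 monic_neq0.
  by move: sgN; rewrite sg; lia.
have gLE : map_poly emb g = orbit_poly d x * map_poly emb g1.
  by rewrite gE rmorphM /= orbit_polyFE// mulrC.
have mg1L : map_poly emb g1 \is monic by rewrite map_monic.
rewrite [in RHS]gLE (permP (root_seqM (monic_orbit_poly d x) mg1L)) count_cat.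
rewrite (permP (root_seq_prod _)) (count_uniq_mem _ ud).
have -> : x \in frob_orbit d x.
  by apply/mapP; exists 0%N; rewrite ?mem_iota ?expr1.
rewrite -(IH g1 N') //; last 2 first.
- by move: sgn; rewrite sg; lia.
- by move: sgN; rewrite sg NE; lia.
rewrite NE big_split_ord /=; congr (_ + _)%N.
  case: d d0 xd dmin' Pg {exd dmin ud mPF sg NE gLE gE} => // d _ xd dmin' Pg.
  rewrite big_ord_recr /= xd eqxx Pg big1// => i _.
  by rewrite (negPf (dmin' _ _))//= ltnS ltn_ord.
apply: eq_bigr => i _; rewrite -addnS pow_qD xd gLE orbit_polyD//.
by rewrite dvdp_mul2l// monic_neq0// monic_orbit_poly.
Qed.
End Lfunction.

(** * The L-function *)

Lemma recip_prod_coef0 (A : comNzRingType) (r : seq A) : (recip_prod r)`_0 = 1.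
Proof.
rewrite /recip_prod; elim: r => [|x r IH]; first by rewrite big_nil coef1.
by rewrite big_cons coef_1BZX_mul IH mulr0 subr0.
Qed.

Lemma newton_power_sum (A : comNzRingType) (r : seq A) k :
  \sum_(x <- r) x ^+ k.+1 = - ((recip_prod r)`_k.+1 *+ k.+1)
    - \sum_(i < k) (recip_prod r)`_i.+1 * \sum_(x <- r) x ^+ (k - i).
Proof.
by rewrite -newton_identity big_ord_recl recip_prod_coef0 mul1r subn0 addrK.
Qed.

Lemma power_sum_eq_coef (A : comNzRingType) (r r' : seq A) s :
  (forall k, (k < s)%N -> (recip_prod r')`_k = (recip_prod r)`_k) ->
  forall k, (0 < k < s)%N -> \sum_(x <- r') x ^+ k = \sum_(x <- r) x ^+ k.
Proof.
move=> e k; have [n] := ubnP k; elim: n k => // n IH [|k] //= kn ks.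
rewrite !newton_power_sum e//; congr (_ - _); apply: eq_bigr => i _.
have := ltn_ord i => ik.
rewrite e ?(leq_trans _ ks)// ?ltnS ?(ltnW ik)//; congr (_ * _); apply: IH; lia.
Qed.

(** In Newton's identity of index [s], the coefficient of degree [s] occurs only in the term
    [- s h_s]; the other terms involve lower coefficients and power sums. *)
Lemma power_sum_shift_coef (A : comNzRingType) (r r' : seq A) s delta :
  (0 < s)%N ->
  (forall k, (k < s)%N -> (recip_prod r')`_k = (recip_prod r)`_k) ->
  (recip_prod r')`_s = (recip_prod r)`_s + delta ->
  \sum_(x <- r') x ^+ s = \sum_(x <- r) x ^+ s - delta *+ s.
Proof.
case: s => // s _ e es; rewrite !newton_power_sum es mulrnDl opprD.
rewrite addrAC; congr (_ - _); congr (_ - _); apply: eq_bigr => i _.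
by rewrite e ?ltnS// (power_sum_eq_coef e)//; have := ltn_ord i; lia.
Qed.

Lemma sum_count_mem_undup (T : eqType) (r : seq T) :
  (\sum_(x <- undup r) count_mem x r = size r)%N.
Proof.
rewrite -sum1_size -[RHS]big_undup_iterop_count /=.
apply: eq_bigr => x _.
by rewrite Monoid.iteropE iter_addn_0 mul1n.
Qed.

Section Lsum.
Variables (F : finFieldType) (L : closedFieldType) (emb : {rmorphism F -> L}).
Variables (C : idomainType) (psi : F -> C).
Hypotheses (psi0 : psi 0 = 1) (psiD : {morph psi : x y / x + y >-> x * y}).
Variables (a b : F) (s : nat).
Local Notation q := #|F|.
Local Notation einv := (emb_inv emb).

Let f (x : L) := emb a * x ^+ s + emb b * x.

Let frobq_f x : f x ^+ q = f (x ^+ q).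
Proof.
rewrite -[LHS]/(frobq emb _) rmorphD !rmorphM rmorphXn /= /frobq.
by rewrite -!rmorphXn !expf_card.
Qed.

Lemma emb_invD x y : x ^+ q = x -> y ^+ q = y -> einv (x + y) = einv x + einv y.
Proof.
move=> xq yq; apply: (fmorph_inj emb); rewrite rmorphD !emb_invK//.
by rewrite -[LHS]/(frobq emb _) rmorphD /= /frobq xq yq.
Qed.

Lemma sum_roots_fixed (g : {poly F}) : g \is monic ->
  (\sum_(z <- root_seq (map_poly emb g)) f z) ^+ q
    = \sum_(z <- root_seq (map_poly emb g)) f z.
Proof.
move=> mg; have mgL : map_poly emb g \is monic by rewrite map_monic.
rewrite -[LHS]/(frobq emb _) rmorph_sum /=.
under eq_bigr => z _ do rewrite /frobq frobq_f.
rewrite -(big_map (fun z => z ^+ q) xpredT f); apply: perm_big.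
apply: prod_XsubC_eq; rewrite big_map -(frobq_prod_XsubC emb) -root_seqE//.
exact: map_frobq_emb.
Qed.

(** This plays the part of a Dirichlet character: it is multiplicative on monic polynomials, since
    the lists of roots are concatenated and [psi] turns sums into products. *)
Definition root_char (g : {poly F}) : C :=
  psi (einv (\sum_(z <- root_seq (map_poly emb g)) f z)).

Lemma root_charM (g1 g2 : {poly F}) : g1 \is monic -> g2 \is monic ->
  root_char (g1 * g2) = root_char g1 * root_char g2.
Proof.
move=> m1 m2; rewrite /root_char -psiD -emb_invD ?sum_roots_fixed//.
congr (psi (einv _)); rewrite -big_cat /=; apply: perm_big.
by rewrite rmorphM /= root_seqM// map_monic.
Qed.

(** The inner sum is the trace to [F] of the value of the binomial at [x], so this is the
    exponential sum over the field of degree [n]. *)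
Definition ext_sum n : C :=
  \sum_(x <- froots F L n) psi (einv (\sum_(z <- frob_orbit F n x) f z)).

Lemma root_char_orbit j x : x ^+ (q ^ j) = x ->
  root_char (orbit_polyF emb j x) = psi (einv (\sum_(z <- frob_orbit F j x) f z)).
Proof.
move=> xj; rewrite /root_char orbit_polyFE//; congr (psi (einv _)).
by apply: perm_big; apply: root_seq_prod.
Qed.

(** The coefficient of degree [n] of the L-function of [root_char]. *)
Definition Lcoef n : C := \sum_(v : 'rV[F]_n) root_char (monic_of v).

Lemma sum_divisible_monic (P : {poly F}) j m : P \is monic -> size P = j.+1 ->
  \sum_(v : 'rV[F]_(j + m) | P %| monic_of v) root_char (monic_of v)
    = root_char P * Lcoef m.
Proof.
move=> mP sP; rewrite /Lcoef mulr_sumr.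
have sPM (w : 'rV[F]_m) : size (P * monic_of w) = (j + m).+1.
  by rewrite size_Mmonic ?monic_monic_of ?monic_neq0// sP size_monic_of addnS.
have mPM (w : 'rV[F]_m) : P * monic_of w \is monic by rewrite monicMl// monic_monic_of.
rewrite (reindex_onto (fun w : 'rV[F]_m => poly_rV (P * monic_of w - 'X^(j + m)))
  (fun v => poly_rV (monic_of v %/ P - 'X^m))) /=.
  apply: eq_big => [w|w _].
    rewrite monic_of_poly_rV// dvdp_mulr// mulKp ?monic_neq0//.
    by rewrite poly_rV_monic_of eqxx.
  by rewrite monic_of_poly_rV// root_charM// monic_monic_of.
move=> v /dvdpP[g gE].
have mg : g \is monic by move: (monic_monic_of v); rewrite gE monicMr.
rewrite gE mulpK ?monic_neq0// monic_of_poly_rV//.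
  by rewrite mulrC -gE poly_rV_monic_of.
have := size_monic_of v; rewrite gE size_Mmonic ?monic_neq0// sP addnS /=; lia.
Qed.

(** Each distinct root contributes its multiplicity, and the multiplicities add up to the degree. *)
Lemma count_orbit_divisors n (v : 'rV[F]_n) (g := map_poly emb (monic_of v)) :
  (\sum_(j < n) \sum_(x <- froots F L j.+1) (orbit_poly F j.+1 x %| g)%R = n)%N.
Proof.
have mg : g \is monic by rewrite map_monic monic_monic_of.
have sr : size (root_seq g) = n.
  by apply: succn_inj; rewrite size_root_seq// size_map_poly size_monic_of.
rewrite -[RHS]sr -sum_count_mem_undup.
under [RHS]eq_bigr => x _ do
  rewrite -(orbit_multiplicity emb x (monic_monic_of v) (eq_leq (size_monic_of v))).
rewrite exchange_big /=; apply: eq_bigr => j _.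
pose P x := (x ^+ (q ^ j.+1) == x) && (orbit_poly F j.+1 x %| g).
have Proot x : P x -> x \in root_seq g.
  move=> /andP[_ /dvdpP[r gr]]; rewrite mem_root_seq// gr rootM.
  by rewrite /orbit_poly big_frob_orbit big_ord_recl /= rootM expr1 root_XsubC eqxx orbT.
transitivity (count P (froots F L j.+1)).
  rewrite -sum1_count [RHS]big_mkcond /=; apply: eq_big_seq => x.
  by rewrite mem_froots// /P => /eqP ->; rewrite eqxx; case: (_ %| _).
transitivity (count P (undup (root_seq g))); last first.
  by rewrite -sum1_count big_mkcond /=; apply: eq_bigr => x _; rewrite /P; case: (_ && _).
rewrite -!size_filter; apply/perm_size/uniq_perm; rewrite ?filter_uniq ?undup_uniq ?uniq_froots//.
move=> x; rewrite !mem_filter mem_undup mem_froots//.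
have [Px|//] := boolP (P x); rewrite Proot//=.
by case/andP: Px.
Qed.

(** Each monic polynomial is counted [n] times, once per orbit polynomial dividing it. After
    exchanging the sums, the multiples of a given orbit polynomial factor by multiplicativity. *)
Lemma Lcoef_recurrence n :
  Lcoef n *+ n = \sum_(j < n) ext_sum j.+1 * Lcoef (n - j.+1).
Proof.
rewrite /Lcoef -sumrMnl.
under eq_bigr => v _ do
  rewrite -{2}(count_orbit_divisors v) -sumrMnr.
rewrite exchange_big /=; apply: eq_bigr => j _.
under eq_bigr => v _ do rewrite -sumrMnr.
rewrite exchange_big /= mulr_suml; apply: eq_big_seq => x.
rewrite mem_froots// => /eqP xj.
rewrite -root_char_orbit// -(sum_divisible_monic (n - j.+1)
  (@monic_orbit_polyF _ _ emb _ _ xj) (@size_orbit_polyF _ _ emb _ _ xj)).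
rewrite subnKC// [RHS]big_mkcond /=; apply: eq_bigr => v _.
by rewrite -(@orbit_polyFE _ _ emb _ _ xj) dvdp_map; case: (_ %| _).
Qed.

Hypotheses (a0 : a != 0) (s_gt1 : (1 < s)%N) (s0 : s%:R != 0 :> F).
Hypothesis (psi_nt : exists x, psi x != 1).

Lemma Lcoef0 : Lcoef 0 = 1.
Proof.
rewrite /Lcoef (big_pred1 0) => [|v]; last by rewrite /= thinmx0; apply/esym/eqP.
rewrite /root_char /monic_of expr0 thinmx0 raddf0 addr0 rmorph1.
have : size (root_seq (1 : {poly L})) = 0%N.
  by apply: succn_inj; rewrite size_root_seq ?monic1// size_poly1.
move=> /size0nil->; rewrite big_nil -(rmorph0 emb) embK psi0//.
Qed.

(* Adding [d] to the coefficient of degree [n - s] shifts the [s]-th power sum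
   of the roots by [- s d] and fixes the first one. *)
Lemma Lcoef_eq0 n : (s <= n)%N -> Lcoef n = 0.
Proof.
move=> sn; have [x0 psix0] := psi_nt.
(* The solution of [- a s d = x0]: the translation by [e] then multiplies [root_char] by [psi x0],
   which is not [1], so the sum over all monic polynomials vanishes. *)
pose d := - (x0 / (a * s%:R)).
have nsn : (n - s < n)%N by rewrite ltn_subrL (ltnW s_gt1) (leq_trans (ltnW s_gt1)).
pose e : 'rV[F]_n := d *: delta_mx 0 (Ordinal nsn).
have coef_e v k : (monic_of (v + e))`_k = (monic_of v)`_k + d *+ (k == n - s)%N.
  rewrite /monic_of raddfD addrA coefD; congr (_ + _).
  rewrite coef_rVpoly; case: insubP => [i _ <-|/=].
    by rewrite !mxE eqxx /= -val_eqE /= mulr_natr.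
  by rewrite -leqNgt => nk; rewrite gtn_eqF// (leq_trans nsn).
have shift v : root_char (monic_of (v + e)) = psi x0 * root_char (monic_of v).
  have mL (w : 'rV[F]_n) : map_poly emb (monic_of w) \is monic.
    by rewrite map_monic monic_monic_of.
  have szr (w : 'rV[F]_n) : size (root_seq (map_poly emb (monic_of w))) = n.
    by apply: succn_inj; rewrite size_root_seq// size_map_poly size_monic_of.
  have rec (w : 'rV[F]_n) k : (k <= n)%N ->
      (recip_prod (root_seq (map_poly emb (monic_of w))))`_k = emb (monic_of w)`_(n - k).
    by move=> kn; rewrite recip_prod_coef ?szr// -root_seqE// coef_map.
  have low k : (k < s)%N ->
      (recip_prod (root_seq (map_poly emb (monic_of (v + e)))))`_k =
      (recip_prod (root_seq (map_poly emb (monic_of v))))`_k.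
    move=> ks; have kn := leq_trans (ltnW ks) sn.
    rewrite !rec// coef_e (_ : _ == _ = false) ?addr0//.
    by apply/negP => /eqP; lia.
  have top : (recip_prod (root_seq (map_poly emb (monic_of (v + e)))))`_s =
      (recip_prod (root_seq (map_poly emb (monic_of v))))`_s + emb d.
    by rewrite !rec// coef_e eqxx rmorphD.
  have p1 := power_sum_eq_coef low (_ : (0 < 1 < s)%N); move/(_ s_gt1) in p1.
  have ps := power_sum_shift_coef (ltnW s_gt1) low top.
  rewrite /root_char -[in RHS](embK emb x0) -psiD -emb_invD ?sum_roots_fixed ?monic_monic_of//; last first.
    by rewrite -rmorphXn expf_card.
  congr (psi (einv _)); rewrite /f !big_split /= -!mulr_sumr.
  move: p1; rewrite /= => ->; rewrite ps mulrBr addrA; congr (_ + _).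
  rewrite addrC; congr (_ + _).
  rewrite -mulr_natr -(rmorph_nat emb) -!rmorphM -rmorphN; congr (emb _).
  by rewrite /d; field; rewrite a0 s0.
have : Lcoef n = psi x0 * Lcoef n.
  rewrite {1}/Lcoef (reindex_inj (addIr e)) mulr_sumr.
  by apply: eq_bigr => v _; rewrite shift.
move/eqP; rewrite -subr_eq0 -{1}[Lcoef n]mul1r -mulrBl mulf_eq0.
by rewrite subr_eq0 eq_sym (negPf psix0) => /eqP.
Qed.
End Lsum.

(** * Weil's bound *)

Section Weil.
Variables (R : realType) (F : finFieldType) (psi : F -> R[i]).
Hypotheses (psi0 : psi 0 = 1) (psiD : {morph psi : x y / x + y >-> x * y}).
Local Notation q := #|F|.

Lemma char_mulrn x n : psi (x *+ n) = psi x ^+ n.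
Proof. by elim: n => [|n IH]; rewrite ?mulr0n ?psi0// mulrS psiD IH exprS. Qed.

Lemma cabs_char x : cabs (psi x) = 1.
Proof.
have : cabs (psi x) ^+ q = 1.
  by rewrite -cabsX -char_mulrn -mulr_natr card_finField_natr mulr0 psi0 (cabs_nat _ 1).
by move/eqP; rewrite pexpr_eq1 ?cabs_ge0// => [/eqP//|]; apply: ltnW; apply: finNzRing_gt1.
Qed.

Hypothesis (psi_nt : exists x, psi x != 1).

Lemma char_sum_eq0 : \sum_x psi x = 0.
Proof.
have [x0 x01] := psi_nt.
have : \sum_x psi x = psi x0 * \sum_x psi x.
  rewrite {1}(reindex_inj (addrI x0)) mulr_sumr.
  by apply: eq_bigr => x _; rewrite psiD.
move/eqP; rewrite -subr_eq0 -{1}[\sum_x _]mul1r -mulrBl mulf_eq0.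
by rewrite subr_eq0 eq_sym (negPf x01) => /eqP.
Qed.

Variables (a b : F) (s : nat).
Hypotheses (a0 : a != 0) (s_gt1 : (1 < s)%N) (s0 : s%:R != 0 :> F).
Variables (L : closedFieldType) (emb : {rmorphism F -> L}).
Local Notation einv := (emb_inv emb).
Local Notation f := (fun x : L => emb a * x ^+ s + emb b * x).
Local Notation S := (ext_sum emb psi a b s).
Local Notation c := (Lcoef emb psi a b s).

Lemma ext_sum_bound m : (0 < m)%N -> (s.+2 <= q ^ m)%N ->
  cabs (S (m + m)) <= (q * s.*2.+2)%:R * q%:R ^+ m.
Proof.
case: m => // m _ sB; set n := (m.+1 + m.+1)%N.
have n0 : (0 < n)%N by [].
pose tr (x : L) := \sum_(z <- frob_orbit F n x) f z.
have fq x i : f x ^+ (q ^ i) = f (x ^+ (q ^ i)).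
  rewrite exprqD// !exprMn !emb_expq -!exprM; congr (_ * _ + _).
  by rewrite mulnC.
have trq x : x ^+ (q ^ n) = x -> tr x ^+ q = tr x.
  move=> xn; rewrite -[LHS]/(frobq emb _) rmorph_sum /= /tr.
  rewrite -[RHS](frob_orbit_shift _ _ xn); apply: eq_bigr => z _.
  by have := fq z 1%N; rewrite expn1.
pose N d := count (fun x => einv (tr x) == d) (froots F L n).
pose D := (q ^ m * q ^ m.+1 + s.*2.+2 * q ^ m.+1)%N.
have ND d : (N d <= D)%N.
  rewrite /N -size_filter.
  apply: (@stepanov_count F L emb m s a b d) => //.
  - by rewrite filter_uniq// uniq_froots.
  - move=> x; rewrite mem_filter mem_froots// => /andP[_ /eqP xn].
    by rewrite -expnD.
  move=> x; rewrite mem_filter mem_froots// => /andP[/eqP <- /eqP xn] /=.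
  rewrite emb_invK ?trq// /tr big_frob_orbit big_split_ord /=.
  have hE (x0 : L) : (map_poly emb (binomial_poly a b s)).[x0] = f x0.
    rewrite /binomial_poly rmorphD /= !map_polyZ map_polyXn map_polyX.
    by rewrite hornerD !hornerZ hornerXn hornerX.
  congr (_ + _); first by apply: eq_bigr => i _; rewrite hE fq.
  rewrite expr_sum_pchar ?pnat_charL//; apply: eq_bigr => i _.
  by rewrite -[in LHS]exprM -expnD addnC hE fq.
have sumN : (\sum_d N d = q ^ n)%N.
  rewrite -(@size_froots F L _ n0) /N -sum1_size.
  under eq_bigr => d _ do rewrite -sum1_count big_mkcond /=.
  rewrite exchange_big /=; apply: eq_bigr => x _.
  by rewrite -big_mkcond (big_pred1 (einv (tr x)))// => d; rewrite eq_sym.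
have SE : S n = \sum_d (N d)%:R * psi d.
  rewrite /ext_sum -/tr.
  under [RHS]eq_bigr => d _ do
    rewrite /N -sum1_count natr_sum mulr_suml big_mkcond /=.
  rewrite exchange_big /=; apply: eq_bigr => x _.
  by rewrite -big_mkcond (big_pred1 (einv (tr x))) ?mul1r// => d; rewrite eq_sym.
(* Subtracting the constant [D] changes nothing, as [psi] sums to zero, and makes all coefficients
   nonnegative. Their total is [q D - q^n], where the main term [q * (q^m * q^(m+1))] of [q D]
   cancels [q^n] exactly. *)
have -> : S n = - \sum_d (D - N d)%:R * psi d.
  under [in RHS]eq_bigr => d _ do rewrite natrB// mulrBl.
  by rewrite big_split /= sumrN -mulr_sumr char_sum_eq0 mulr0 add0r opprK SE.
rewrite cabsN.
apply: le_trans (cabs_sum _ _ _) _.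
under eq_bigr => d _ do rewrite cabsM cabs_char cabs_nat mulr1.
rewrite -natr_sum -natrX -natrM ler_nat sumnB// sumN sum_nat_const cardT.
rewrite -cardE leq_subLR /D mulnDr !mulnA.
by rewrite -expnS -expnD.
Qed.

(** The L-function with its coefficients reversed: it is monic, and its roots are the inverses of
    the zeros of the L-function, with [0] allowed when the degree drops. *)
Let Lpoly : {poly R[i]} := \poly_(i < s) c (s.-1 - i).

Let s_gt0 : (0 < s)%N := ltnW s_gt1.

Let size_Lpoly : size Lpoly = s.
Proof.
rewrite size_poly_eq// subnn Lcoef0// oner_neq0//.
Qed.

Let monic_Lpoly : Lpoly \is monic.
Proof.
by rewrite monicE lead_coefE size_Lpoly coef_poly prednK// leqnn subnn Lcoef0.
Qed.

Lemma recip_prod_Lpoly k : (recip_prod (root_seq Lpoly))`_k = c k.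
Proof.
have sr : size (root_seq Lpoly) = s.-1.
  by apply: succn_inj; rewrite size_root_seq// size_Lpoly prednK.
have [ks|sk] := ltnP k s.
  have ks' : (k <= s.-1)%N by rewrite -ltnS prednK.
  rewrite recip_prod_coef ?sr// -root_seqE// coef_poly subKn//.
  by rewrite ifT//; lia.
rewrite Lcoef_eq0// nth_default//; apply: leq_trans (size_recip_prod _) _.
by rewrite sr prednK.
Qed.

(** Up to sign, [Lcoef_recurrence] and Newton's identities are the same recurrence, with leading
    coefficient [1]. *)
Lemma ext_sum_root k : S k.+1 = - \sum_(w <- root_seq Lpoly) w ^+ k.+1.
Proof.
have [n] := ubnP k; elim: n k => // n IH k kn.
rewrite newton_power_sum opprD !opprK.
rewrite recip_prod_Lpoly (Lcoef_recurrence _ psiD) big_ord_recr /=.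
rewrite subnn Lcoef0// mulr1 -[LHS]add0r addrAC; congr (_ + _); apply/esym.
rewrite (reindex_inj rev_ord_inj) -big_split big1//= => i _.
have ik := ltn_ord i.
rewrite IH; last by lia.
rewrite recip_prod_Lpoly (_ : (k.+1 - (k - i.+1).+1 = i.+1)%N); last by lia.
rewrite (_ : ((k - i.+1).+1 = k - i)%N); last by lia.
by rewrite mulNr [X in - X]mulrC addNr.
Qed.

Lemma ext_sum1 : S 1 = \sum_(x : F) psi (a * x ^+ s + b * x).
Proof.
rewrite /ext_sum (perm_big [seq emb x | x <- enum F]) /=; last first.
  apply: uniq_perm; rewrite ?uniq_froots//.
    by rewrite map_inj_uniq ?enum_uniq//; apply: fmorph_inj.
  move=> x; rewrite mem_froots// expn1; apply/eqP/mapP => [xq|[y _ ->]].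
    by exists (einv x); rewrite ?mem_enum// emb_invK.
  by rewrite -rmorphXn expf_card.
rewrite big_map big_enum /=; apply: eq_bigr => x _.
rewrite big_frob_orbit big_ord1 expr1; congr psi.
by rewrite -rmorphXn -!rmorphM -rmorphD embK.
Qed.

Lemma weil_bound_emb :
  cabs (\sum_(x : F) psi (a * x ^+ s + b * x)) <= s%:R * Num.sqrt q%:R.
Proof.
rewrite -ext_sum1 ext_sum_root.
rewrite cabsN.
apply: le_trans (cabs_sum _ _ _) _.
have q0 : 0 < q%:R :> R by rewrite ltr0n ltnW// finNzRing_gt1.
have wb w : w \in root_seq Lpoly -> cabs w <= Num.sqrt q%:R.
  move=> wr; have w2 : cabs (w ^+ 2) <= q%:R.
    (* Only the sums of even degree are bounded, so the growth argument runs on the squares of the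
       roots. The threshold [s.+2] guarantees [s.+2 <= q ^ m] from there on. *)
    apply: (@power_sum_growth R [seq z ^+ 2 | z <- root_seq Lpoly]
      (q * s.*2.+2)%:R q%:R s.+2 q0) => [|//]; last exact: (map_f (fun z => z ^+ 2) wr).
    move=> m sm; have m0 : (0 < m)%N by apply: leq_trans sm.
    have -> : \sum_(z <- [seq z ^+ 2 | z <- root_seq Lpoly]) z ^+ m = - S (m + m).
      rewrite big_map -{2}(prednK m0) addSn ext_sum_root opprK.
      by apply: eq_bigr => z _; rewrite -exprM; congr (_ ^+ _); lia.
    rewrite cabsN ext_sum_bound// (leq_trans sm)// ltnW// ltn_expl//.
    exact: finNzRing_gt1.
  rewrite -(ler_pXn2r (n := 2))// ?nnegrE ?cabs_ge0 ?sqrtr_ge0//.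
  by rewrite sqr_sqrtr ?(ltW q0)// -cabsX.
rewrite (le_trans (y := \sum_(w <- root_seq Lpoly) Num.sqrt q%:R))//.
  by rewrite [leLHS]big_seq [leRHS]big_seq; apply: ler_sum => w wr; rewrite expr1 wb.
rewrite big_const_seq count_predT iter_addr addr0 -[_ *+ _]mulr_natl.
rewrite ler_wpM2r ?sqrtr_ge0// ler_nat -ltnS size_root_seq// size_Lpoly.
exact: leqnSn.
Qed.
End Weil.

Lemma weil_bound (R : realType) (F : finFieldType) (psi : F -> R[i])
    (a b : F) (s : nat) :
  psi 0 = 1 -> {morph psi : x y / x + y >-> x * y} -> (exists x, psi x != 1) ->
  a != 0 -> (1 < s)%N -> s%:R != 0 :> F ->
  cabs (\sum_(x : F) psi (a * x ^+ s + b * x)) <= s%:R * Num.sqrt #|F|%:R.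
Proof.
move=> *; have [L [emb _]] := countable_algebraic_closure F.
exact: (@weil_bound_emb R F psi _ _ _ a b s _ _ _ L emb).
Qed.

(** Summed over all [g], the correlations of [chi] with [x -> psi (g * x)] total [q], only [x = 0]
    contributing. Hence one is nonzero, and the quotient of the two characters, whose sum does not
    vanish, is trivial. *)
Lemma char_dual (R : realType) (F : finFieldType) (psi chi : F -> R[i]) :
  psi 0 = 1 -> {morph psi : x y / x + y >-> x * y} -> (exists x, psi x != 1) ->
  chi 0 = 1 -> {morph chi : x y / x + y >-> x * y} ->
  exists g, forall x, chi x = psi (g * x).
Proof.
move=> psi0 psiD psint chi0 chiD.
have tot : \sum_g \sum_x chi x * psi (- (g * x)) != 0.
  rewrite exchange_big /= (bigD1 0)//= [X in _ + X]big1 => [|x x0].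
    rewrite addr0 (eq_bigr (fun=> 1)) => [|g _].
      by rewrite sumr_const pnatr_eq0 cardT -cardE -lt0n ltnW// finNzRing_gt1.
    by rewrite mulr0 oppr0 psi0 chi0 mulr1.
  rewrite -mulr_sumr (reindex_inj (mulIf (_ : - x^-1 != 0))) /=.
    under eq_bigr => g _ do rewrite mulrN mulNr opprK mulfVK//.
    by rewrite char_sum_eq0// mulr0.
  by rewrite oppr_eq0 invr_eq0.
have [g gn0] : exists g, \sum_x chi x * psi (- (g * x)) != 0.
  apply/existsP; rewrite -[[exists _, _]]negbK negb_exists; apply/negP => /forallP h.
  by move: tot; rewrite big1 ?eqxx// => g _; apply/eqP; rewrite -[_ == 0]negbK.
exists g => x.
pose om y := chi y * psi (- (g * y)).
have omx : om x = 1.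
  apply/eqP; apply: contraTT gn0 => omx; rewrite negbK; apply/eqP.
  apply: (@char_sum_eq0 R F om); last by exists x.
  move=> y z; rewrite /om chiD mulrDr opprD psiD; ring.
by rewrite -[RHS]mul1r -omx /om -mulrA -psiD addNr psi0 mulr1.
Qed.

(* When [s] is a multiple of the characteristic, write [s = p ^ e * s'] and
   replace [psi] by its composition with the [e]-th power of Frobenius. *)
Lemma weil_bound_pchar (R : realType) (F : finFieldType) (psi : F -> R[i])
    (a b : F) (s : nat) :
  psi 0 = 1 -> {morph psi : x y / x + y >-> x * y} -> (exists x, psi x != 1) ->
  a != 0 -> (0 < s)%N -> ~~ [pchar F].-nat s ->
  cabs (\sum_(x : F) psi (a * x ^+ s + b * x)) <= s%:R * Num.sqrt #|F|%:R.
Proof.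
move=> psi0 psiD psint a0 s0 sch.
have [p p_pr chp] := finPcharP F.
move: sch; rewrite (eq_pnat _ (pcharf_eq chp)) => sch.
set N := (s`_p)%N; set s1 := (s`_p^')%N.
have sE : s = (s1 * N)%N by rewrite mulnC partnC.
have N0 : (0 < N)%N by apply: part_gt0.
have chN : [pchar F].-nat N by rewrite (eq_pnat _ (pcharf_eq chp)) part_pnat.
have s1_gt1 : (1 < s1)%N.
  have s1_gt0 : (0 < s1)%N by apply: part_gt0.
  rewrite ltn_neqAle s1_gt0 andbT eq_sym; apply: contra sch => /eqP s11.
  by rewrite sE s11 mul1n part_pnat.
have s1F : s1%:R != 0 :> F.
  rewrite -(dvdn_pcharf chp); apply/negP => ps1.
  have := part_pnat p^' s; rewrite -/s1 => /(pnat_dvd ps1).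
  by rewrite pnatE// !inE eqxx.
have powI : injective (fun x : F => x ^+ N).
  move=> x y /= e; apply/eqP; rewrite -subr_eq0.
  suff : (x - y) ^+ N == 0 by rewrite expf_eq0 N0.
  by apply/eqP/(addIr (y ^+ N)); rewrite add0r -exprDn_pchar// subrK.
have [powV powVK Kpow] : bijective (fun x : F => x ^+ N) by apply: injF_bij.
pose psi' x := psi (x ^+ N).
have psi'0 : psi' 0 = 1 by rewrite /psi' expr0n gtn_eqF.
have psi'D : {morph psi' : x y / x + y >-> x * y}.
  by move=> x y; rewrite /psi' exprDn_pchar.
have psi'nt : exists x, psi' x != 1.
  by have [x x1] := psint; exists (powV x); rewrite /psi' Kpow.
(* The linear term is not a Frobenius power, but [x -> psi (b * x)] is a character, hence of the
   form [psi' (g * x)]. *)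
have [||g gE] := char_dual psi'0 psi'D psi'nt (chi := fun x => psi (b * x)).
- by rewrite mulr0.
- by move=> x y; rewrite mulrDr psiD.
have aV0 : powV a != 0.
  by apply: contra a0 => /eqP e; rewrite -(Kpow a) e expr0n gtn_eqF.
rewrite (eq_bigr (fun x => psi' (powV a * x ^+ s1 + g * x))) => [|x _]; last first.
  by rewrite psiD psi'D -gE /psi' exprMn Kpow -exprM -sE.
apply: le_trans (weil_bound _ psi'0 psi'D psi'nt aV0 s1_gt1 s1F) _.
by rewrite ler_wpM2r ?sqrtr_ge0// ler_nat sE leq_pmulr.
Qed.

(** * Moments of the Fourier transform of a subset of a regular variety *)

Lemma cauchy_schwarz_sum (R : realFieldType) (I : finType) (f g : I -> R) :
  (\sum_i f i * g i) ^+ 2 <= (\sum_i f i ^+ 2) * (\sum_i g i ^+ 2).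
Proof.
have : 0 <= \sum_i \sum_j (f i * g j - f j * g i) ^+ 2.
  by apply: sumr_ge0 => i _; apply: sumr_ge0 => j _; apply: sqr_ge0.
have -> : \sum_i \sum_j (f i * g j - f j * g i) ^+ 2 =
   \sum_i \sum_j f i ^+ 2 * g j ^+ 2 + \sum_i \sum_j g i ^+ 2 * f j ^+ 2
   - (\sum_i \sum_j (f i * g i) * (f j * g j)) *+ 2.
  rewrite -sumrMnl -big_split -sumrB /=; apply: eq_bigr => i _.
  rewrite -sumrMnl -big_split -sumrB /=; apply: eq_bigr => j _.
  ring.
have sp (f1 g1 : I -> R) : \sum_i \sum_j f1 i * g1 j = (\sum_i f1 i) * (\sum_j g1 j).
  by rewrite mulr_suml; apply: eq_bigr => i _; rewrite mulr_sumr.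
rewrite (sp (fun i => f i ^+ 2) (fun i => g i ^+ 2)).
rewrite (sp (fun i => g i ^+ 2) (fun i => f i ^+ 2)).
rewrite (sp (fun i => f i * g i) (fun i => f i * g i)).
by rewrite [X in _ + X - _]mulrC expr2 mulr2n; lra.
Qed.

Section Fourier.
Variables (R : realType) (F : finFieldType) (chi : F -> R[i]).
Hypotheses (chi0 : chi 0 = 1) (chiD : {morph chi : x y / x + y >-> x * y}).
Hypothesis (chi_nt : exists x, chi x != 1).
Variable d : nat.
Local Notation q := #|F|.
Implicit Types (m x y : 'rV[F]_d) (E V : {set 'rV[F]_d}).

Lemma dotvDr m : {morph dotv m : x y / x + y}.
Proof.
move=> x y; rewrite /dotv -big_split; apply: eq_bigr => j _.
by rewrite mxE mulrDr.
Qed.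

Lemma dotvN m x : dotv m (- x) = - dotv m x.
Proof. by rewrite /dotv -sumrN; apply: eq_bigr => j _; rewrite mxE mulrN. Qed.

Lemma dotvDl m m' x : dotv (m + m') x = dotv m x + dotv m' x.
Proof.
by rewrite /dotv -big_split; apply: eq_bigr => j _; rewrite mxE mulrDl.
Qed.

Lemma dotv0r m : dotv m 0 = 0.
Proof. by rewrite /dotv big1// => j _; rewrite mxE mulr0. Qed.

Lemma chiN (x : F) : chi (- x) = conjc (chi x).
Proof.
have x1 : chi x * chi (- x) = 1 by rewrite -chiD subrr.
have n1 : chi x * conjc (chi x) = 1.
  by rewrite -sqr_normc cabsE cabs_char// expr1n.
have x0 : chi x != 0 by apply: contra_eq_neq x1 => ->; rewrite mul0r eq_sym oner_neq0.
by apply: (mulfI x0); rewrite x1 n1.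
Qed.

Lemma char_sum_dotv x :
  \sum_m chi (dotv m x) = if x == 0 then q%:R ^+ d else 0.
Proof.
have [->|x0] := eqVneq x 0.
  under eq_bigr => m _ do rewrite dotv0r chi0.
  by rewrite sumr_const card_mx mul1n natrX.
have [z z1] := chi_nt; case/rV0Pn: x0 => j xj.
pose m0 : 'rV[F]_d := (z / x 0 j) *: delta_mx 0 j.
have m0x : dotv m0 x = z.
  rewrite /dotv (bigD1 j)//= big1 => [|i ij].
    by rewrite !mxE !eqxx mulr1 addr0 mulfVK.
  by rewrite !mxE (negPf ij) mulr0 mul0r.
have : \sum_m chi (dotv m x) = chi z * \sum_m chi (dotv m x).
  rewrite {1}(reindex_inj (addrI m0)) mulr_sumr.
  by apply: eq_bigr => m _; rewrite dotvDl m0x chiD.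
move/eqP; rewrite -subr_eq0 -{1}[\sum_x _]mul1r -mulrBl mulf_eq0.
by rewrite subr_eq0 eq_sym (negPf z1) => /eqP.
Qed.

Definition ehat E m : R[i] := \sum_(x in E) chi (dotv m x).
Definition moment E n : R := \sum_m cabs (ehat E m) ^+ n.

Lemma conj_ehat E m : conjc (ehat E m) = \sum_(x in E) chi (- dotv m x).
Proof. by rewrite rmorph_sum; apply: eq_bigr => x _; rewrite chiN. Qed.

Lemma ehat_le E m : cabs (ehat E m) <= #|E|%:R.
Proof.
apply: le_trans (cabs_sum _ _ _) _.
by under eq_bigr => x _ do rewrite cabs_char//; rewrite sumr_const.
Qed.

Lemma moment_ge0 E n : 0 <= moment E n.
Proof. by apply: sumr_ge0 => m _; rewrite exprn_ge0 ?cabs_ge0. Qed.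

Lemma cabs_sqr (z : R[i]) : (cabs z ^+ 2)%:C = z * conjc z.
Proof. by rewrite -sqr_normc cabsE rmorphXn. Qed.

Lemma moment2 E : moment E 2 = q%:R ^+ d * #|E|%:R.
Proof.
apply: complexI; rewrite rmorph_sum rmorphM rmorphXn /= !rmorph_nat.
under eq_bigr => m _ do rewrite cabs_sqr conj_ehat mulr_suml.
rewrite exchange_big /=.
rewrite [RHS]mulr_natr -sumr_const; apply: eq_bigr => x xE.
under eq_bigr => m _ do rewrite mulr_sumr.
rewrite exchange_big /= (bigD1 x)//= [X in _ + X]big1 => [|y /andP[_ yx]].
  under eq_bigr => m _ do rewrite -chiD -dotvN -dotvDr.
  by rewrite char_sum_dotv subrr eqxx addr0.
under eq_bigr => m _ do rewrite -chiD -dotvN -dotvDr.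
by rewrite char_sum_dotv subr_eq0 eq_sym (negPf yx).
Qed.

(** For products of powers of [ehat] and its conjugate, this transform is [q^d] times a number of
    representations by sums and differences of elements of [E]; positivity alone is recorded, and in
    [R[i]] it includes being real. *)
Definition pos_transform (g : 'rV[F]_d -> R[i]) :=
  forall x, 0 <= \sum_m g m * chi (dotv m x).

Lemma pos_transform_ext g g' : g =1 g' -> pos_transform g -> pos_transform g'.
Proof. by move=> e gp x; under eq_bigr => m _ do rewrite -e; apply: gp. Qed.

Lemma pos_transform1 : pos_transform (fun=> 1).
Proof.
move=> x; under eq_bigr => m _ do rewrite mul1r.
by rewrite char_sum_dotv; case: eqP => // _; rewrite exprn_ge0.
Qed.

Lemma pos_transform_ehat E g : pos_transform g ->
  pos_transform (fun m => g m * ehat E m).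
Proof.
move=> gp x.
have -> : \sum_m g m * ehat E m * chi (dotv m x)
    = \sum_(y in E) \sum_m g m * chi (dotv m (y + x)).
  rewrite exchange_big /=; apply: eq_bigr => m _.
  rewrite -mulrA mulr_suml mulr_sumr; apply: eq_bigr => y _.
  by rewrite dotvDr chiD.
by apply: sumr_ge0.
Qed.

Lemma pos_transform_conj_ehat E g : pos_transform g ->
  pos_transform (fun m => g m * conjc (ehat E m)).
Proof.
move=> gp x.
have -> : \sum_m g m * conjc (ehat E m) * chi (dotv m x)
    = \sum_(y in E) \sum_m g m * chi (dotv m (x - y)).
  rewrite exchange_big /=; apply: eq_bigr => m _.
  rewrite -mulrA conj_ehat mulr_suml mulr_sumr; apply: eq_bigr => y _.
  by rewrite dotvDr dotvN chiD [chi (- _) * _]mulrC.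
by apply: sumr_ge0.
Qed.

Lemma pos_transform_expr E i j :
  pos_transform (fun m => ehat E m ^+ i * (conjc (ehat E m)) ^+ j).
Proof.
elim: j => [|j IHj]; last first.
  apply: pos_transform_ext (pos_transform_conj_ehat E IHj) => m.
  by rewrite [in RHS]exprSr mulrA.
elim: i => [|i IHi].
  by apply: pos_transform_ext pos_transform1 => m; rewrite !expr0 mulr1.
apply: pos_transform_ext (pos_transform_ehat E IHi) => m.
by rewrite !expr0 !mulr1 exprSr.
Qed.

(* Positivity of the transform lets one of the [2n] variables in the additive
   energy of [E] range over [V] instead of [E]. *)
Lemma moment_recurrence (K : R) E V n : E \subset V ->
  (forall m, m != 0 -> cabs (\sum_(x in V) chi (- dotv m x)) <= K) ->
  moment E (n.+1.*2) <=
    2 * #|V|%:R * #|E|%:R ^+ (n.*2.+1) + K ^+ 2 * moment E n.*2.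
Proof.
move=> EV hK.
pose Vh m := \sum_(x in V) chi (- dotv m x).
pose g m := ehat E m ^+ n.+1 * (conjc (ehat E m)) ^+ n.
have cJ (z : R[i]) : cabs (conjc z) = cabs z by rewrite /cabs normcJ.
have step1 : (moment E (n.+1.*2))%:C <= \sum_m g m * Vh m.
  have -> : (moment E (n.+1.*2))%:C = \sum_(x in E) \sum_m g m * chi (dotv m (- x)).
    rewrite exchange_big rmorph_sum /=; apply: eq_bigr => m _.
    rewrite -mul2n exprM rmorphXn /= cabs_sqr /g -mulr_sumr.
    under [in RHS]eq_bigr => x _ do rewrite dotvN.
    by rewrite -conj_ehat -mulrA -exprSr exprMn.
  have -> : \sum_m g m * Vh m = \sum_(x in V) \sum_m g m * chi (dotv m (- x)).
    rewrite exchange_big /=; apply: eq_bigr => m _.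
    by rewrite /Vh mulr_sumr; apply: eq_bigr => x _; rewrite dotvN.
  rewrite [leRHS](bigID (mem E)) /=.
  rewrite [X in _ <= X + _](eq_bigl (mem E)) => [|x]; last first.
    by rewrite /=; case: (boolP (x \in E)) => xE; rewrite ?andbF// (subsetP EV _ xE).
  by rewrite lerDl; apply: sumr_ge0 => x _; apply: pos_transform_expr.
have step2 : moment E (n.+1.*2) <= \sum_m cabs (ehat E m) ^+ (n.*2.+1) * cabs (Vh m).
  have /(le_trans step1) : \sum_m g m * Vh m <= (cabs (\sum_m g m * Vh m))%:C.
    rewrite -cabsE real_ler_norm// realE.
    by rewrite (le_trans _ step1)// ler0c moment_ge0.
  rewrite lecR => h; apply: le_trans h _; apply: le_trans (cabs_sum _ _ _) _.
  apply: ler_sum => m _; rewrite /g !cabsM !cabsX cJ -exprD addSn addnn lexx//.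
(* The frequency [0] is bounded trivially. Elsewhere [t * K <= (t^2 + K^2) / 2] puts half of the
   moment on the right, where the left side absorbs it: hence the factor [2]. *)
have step3 m : cabs (ehat E m) ^+ (n.*2.+1) * cabs (Vh m) <=
   (if m == 0 then #|E|%:R ^+ (n.*2.+1) * #|V|%:R else 0) +
   (cabs (ehat E m) ^+ n.+1.*2 + K ^+ 2 * cabs (ehat E m) ^+ n.*2) / 2.
  have [->|m0] := eqVneq m 0.
    apply: le_trans (_ : #|E|%:R ^+ (n.*2.+1) * #|V|%:R <= _).
      rewrite ler_pM ?exprn_ge0 ?cabs_ge0//.
        by rewrite lerXn2r ?nnegrE ?cabs_ge0 ?ehat_le.
      apply: le_trans (cabs_sum _ _ _) _.
      by under eq_bigr => x _ do rewrite cabs_char//; rewrite sumr_const.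
    rewrite lerDl divr_ge0//; apply: addr_ge0; first by apply/exprn_ge0/cabs_ge0.
    by rewrite mulr_ge0 ?sqr_ge0// exprn_ge0// cabs_ge0.
  rewrite add0r doubleS !exprS; set t := cabs (ehat E m).
  have t0 : 0 <= t by apply: cabs_ge0.
  have tn0 : 0 <= t ^+ n.*2 by apply: exprn_ge0.
  apply: le_trans (_ : t * t ^+ n.*2 * K <= _).
    by rewrite ler_wpM2l ?mulr_ge0// hK.
  by have := mulr_ge0 tn0 (sqr_ge0 (t - K)); move: (t ^+ n.*2) => T0 {tn0}; lra.
have := le_trans step2 (ler_sum _ (fun m _ => step3 m)).
rewrite big_split /= -big_mkcond big_pred1_eq -mulr_suml big_split /= -mulr_sumr.
rewrite -!/(moment _ _); lra.
Qed.

(** * Exponential sums of the diagonal polynomial *)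

Lemma ehat_expr E k m :
  ehat E m ^+ k = \sum_(f : {ffun 'I_k -> 'rV[F]_d} | [forall i, f i \in E])
    chi (dotv m (\sum_i f i)).
Proof.
rewrite -[X in _ ^+ X]card_ord -prodr_const bigA_distr_big /=.
apply: eq_big => [f|f _]; first by apply/ffun_onP/forallP.
rewrite (big_morph _ (dotvDr m) (dotv0r m)) (big_morph _ chiD chi0) //.
Qed.

Lemma sum_rV_prod (f : 'I_d -> F -> R[i]) :
  \sum_(y : 'rV[F]_d) \prod_j f j (y 0 j) = \prod_j \sum_z f j z.
Proof.
rewrite bigA_distr_bigA (reindex (fun g : {ffun 'I_d -> F} => \row_j g j)) /=.
  by apply: eq_bigr => g _; apply: eq_bigr => j _; rewrite mxE.
exists (fun y : 'rV[F]_d => [ffun j => y 0 j]) => [g|y] _.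
  by apply/ffunP => j; rewrite ffunE mxE.
by apply/rowP => j; rewrite mxE ffunE.
Qed.

Lemma peval_diag s (a : 'I_d -> F) y :
  peval (diag_poly s a) y = \sum_j a j * y 0 j ^+ s.
Proof.
rewrite /peval /diag_poly rmorph_sum /=; apply: eq_bigr => j _.
by rewrite mevalZ rmorphXn /= mevalXU.
Qed.

(** The phase separates into coordinates, each giving a Weil sum with coefficients [t * a j] and
    [- m 0 j]. *)
Lemma diag_exp_sum_bound s (a : 'I_d -> F) t m :
  (0 < s)%N -> ~~ [pchar F].-nat s -> (forall j, a j != 0) -> t != 0 ->
  cabs (\sum_y chi (t * peval (diag_poly s a) y - dotv m y))
    <= (s%:R * Num.sqrt q%:R) ^+ d.
Proof.
move=> s0 sch a0 t0.
rewrite (eq_bigr (fun y : 'rV[F]_d =>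
    \prod_j chi (t * a j * y 0 j ^+ s + (- m 0 j) * y 0 j))) => [|y _]; last first.
  rewrite -(big_morph _ chiD chi0); congr chi.
  rewrite peval_diag /dotv mulr_sumr -sumrB; apply: eq_bigr => j _.
  by rewrite mulrA mulNr.
rewrite (sum_rV_prod (fun j z => chi (t * a j * z ^+ s + (- m 0 j) * z))).
have -> : forall (f : 'I_d -> R[i]), cabs (\prod_j f j) = \prod_j cabs (f j).
  by move=> f; apply: (big_morph _ (@cabsM R) (cabs_nat R 1)).
rewrite -[X in _ ^+ X]card_ord -prodr_const; apply: ler_prod => j _.
by rewrite cabs_ge0 weil_bound_pchar// mulf_neq0.
Qed.

(** Fourier inversion of [y -> chi (t * P(y))] at the sum of the [f i]: the coefficients are bounded
    uniformly in [m], and summing the characters over [E^k] leaves [ehat E m ^+ k]. *)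
Lemma diag_sumset_char_bound E s k (a : 'I_d -> F) t :
  (0 < s)%N -> ~~ [pchar F].-nat s -> (forall j, a j != 0) -> t != 0 ->
  q%:R ^+ d * cabs (\sum_(f : {ffun 'I_k -> 'rV[F]_d} | [forall i, f i \in E])
     chi (t * peval (diag_poly s a) (\sum_i f i)))
  <= (s%:R * Num.sqrt q%:R) ^+ d * moment E k.
Proof.
move=> s0 sch a0 t0; set P := diag_poly s a.
rewrite -[X in X ^+ d * _ <= _]cabs_nat -cabsX -cabsM mulr_sumr.
rewrite (_ : \sum_(f | _) _ = \sum_m (\sum_y chi (t * peval P y - dotv m y)) * ehat E m ^+ k).
  apply: le_trans (cabs_sum _ _ _) _; rewrite /moment mulr_sumr.
  apply: ler_sum => m _; rewrite cabsM cabsX ler_wpM2r ?exprn_ge0 ?cabs_ge0//.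
  exact: diag_exp_sum_bound.
under [RHS]eq_bigr => m _ do rewrite ehat_expr mulr_sumr.
rewrite exchange_big /=; apply: eq_bigr => f _.
under [RHS]eq_bigr => m _ do rewrite mulr_suml.
rewrite exchange_big /= (bigD1 (\sum_i f i))//= [X in _ + X]big1 => [|y yf].
  rewrite addr0; under [RHS]eq_bigr => m _ do rewrite -chiD subrK.
  by rewrite sumr_const card_mx mul1n -[RHS]mulr_natr natrX mulrC.
under eq_bigr => m _ do rewrite -chiD -addrA [- _ + _]addrC -dotvN -dotvDr chiD.
by rewrite -mulr_sumr char_sum_dotv subr_eq0 eq_sym (negPf yf) mulr0.
Qed.
End Fourier.

(** * Sumsets and numerical estimates *)

Section Sumset.
Variables (R : realType) (F : finFieldType) (chi : F -> R[i]).
Hypotheses (chi0 : chi 0 = 1) (chiD : {morph chi : x y / x + y >-> x * y}).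
Hypothesis (chi_nt : exists x, chi x != 1).
Local Notation q := #|F|.

Lemma char_sum_mulr (z : F) : \sum_t chi (t * z) = if z == 0 then q%:R else 0.
Proof.
have [->|z0] := eqVneq z 0.
  by under eq_bigr => t _ do rewrite mulr0 chi0; rewrite sumr_const.
rewrite (reindex_inj (mulIf (_ : z^-1 != 0))) ?invr_eq0//=.
under eq_bigr => t _ do rewrite mulfVK//.
exact: char_sum_eq0.
Qed.

Definition char_set_sum (X : {set F}) t : R[i] := \sum_(r in X) chi (t * r).

Lemma char_set_parseval (X : {set F}) :
  \sum_t cabs (char_set_sum X t) ^+ 2 = q%:R * #|X|%:R.
Proof.
apply: complexI; rewrite rmorph_sum rmorphM /= !rmorph_nat.
under eq_bigr => t _ do rewrite cabs_sqr /char_set_sum rmorph_sum mulr_suml.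
rewrite exchange_big /= [RHS]mulr_natr -sumr_const; apply: eq_bigr => x xX.
under eq_bigr => m _ do rewrite mulr_sumr.
rewrite exchange_big /= (bigD1 x)//= [X in _ + X]big1 => [|y /andP[_ yx]].
  under eq_bigr => t _ do rewrite -(chiN chi0 chiD) -chiD -mulrBr.
  by rewrite char_sum_mulr subrr eqxx addr0.
under eq_bigr => t _ do rewrite -(chiN chi0 chiD) -chiD -mulrBr.
by rewrite char_sum_mulr subr_eq0 eq_sym (negPf yx).
Qed.

(** Characters count the solutions of [r + v i = y], and there are exactly [|X| |A|] of them because
    all these sums lie in [Y]. The frequency [0] gives the first term; Cauchy-Schwarz and Parseval
    handle the others. Bounding [B] through its square avoids square roots. *)
Lemma sumset_char_bound (I : finType) (A : pred I) (v : I -> F)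
    (X Y : {set F}) (Sm : R) :
  (forall r i, r \in X -> A i -> r + v i \in Y) ->
  (forall t, t != 0 -> cabs (\sum_(i | A i) chi (t * v i)) <= Sm) ->
  exists2 B : R, B ^+ 2 <= (q%:R * #|X|%:R) * (q%:R * #|Y|%:R) &
    q%:R * (#|X|%:R * #|A|%:R) <= #|Y|%:R * (#|X|%:R * #|A|%:R) + Sm * B.
Proof.
move=> hY hS; set h := char_set_sum.
exists (\sum_t cabs (h X t) * cabs (h Y (- t))).
  apply: le_trans (cauchy_schwarz_sum _ _) _.
  rewrite char_set_parseval (reindex_inj oppr_inj) /=.
  by under eq_bigr => t _ do rewrite opprK; rewrite char_set_parseval.
have Sm0 : 0 <= Sm by apply: le_trans (hS 1 (oner_neq0 _)); apply: cabs_ge0.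
pose S t := \sum_(i | A i) chi (t * v i).
have key : (q%:R * (#|X|%:R * #|A|%:R))%:C = \sum_t h X t * S t * h Y (- t) :> R[i].
  transitivity (\sum_(r in X) \sum_(i | A i) \sum_(y in Y) \sum_t
      chi (t * r) * chi (t * v i) * chi (- t * y)); last first.
    rewrite [RHS](eq_bigr (fun t => \sum_(r in X) \sum_(i | A i) \sum_(y in Y)
        chi (t * r) * chi (t * v i) * chi (- t * y))) => [|t _].
      rewrite [RHS]exchange_big /=; apply: eq_bigr => r rX.
      rewrite [RHS]exchange_big /=; apply: eq_bigr => i Ai.
      by rewrite [RHS]exchange_big.
    rewrite /h /char_set_sum /S mulr_suml mulr_suml; apply: eq_bigr => r _.
    rewrite -mulrA mulr_suml mulr_sumr; apply: eq_bigr => i _.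
    by rewrite mulrA mulr_sumr.
  rewrite !rmorphM /= !rmorph_nat mulrC -mulrA mulr_natl -sumr_const.
  apply: eq_bigr => r rX; rewrite mulr_natl -sumr_const; apply: eq_bigr => i Ai.
  rewrite (bigD1 (r + v i)) ?hY//= [X in _ + X]big1 => [|y /andP[_ yx]].
    under eq_bigr => t _ do rewrite -!chiD mulNr -mulrDr addrN chi0.
    by rewrite sumr_const addr0.
  under eq_bigr => t _ do rewrite -!chiD mulNr -mulrDr -mulrBr.
  by rewrite char_sum_mulr subr_eq0 eq_sym (negPf yx).
have X0 (Z : {set F}) : h Z 0 = #|Z|%:R.
  by rewrite /h /char_set_sum; under eq_bigr => r _ do rewrite mul0r chi0; rewrite sumr_const.
have S0 : S 0 = #|A|%:R.
  by rewrite /S; under eq_bigr => r _ do rewrite mul0r chi0; rewrite sumr_const.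
have term t : cabs (h X t * S t * h Y (- t)) <=
    (if t == 0 then #|Y|%:R * (#|X|%:R * #|A|%:R) else 0)
      + Sm * (cabs (h X t) * cabs (h Y (- t))).
  rewrite !cabsM; have [->|t0] := eqVneq t 0.
    rewrite oppr0 !X0 S0 !cabs_nat [X in X <= _]mulrC lerDl.
    by rewrite !mulr_ge0.
  rewrite add0r mulrAC mulrC ler_wpM2r ?hS//.
  by rewrite mulr_ge0 ?cabs_ge0.
have : q%:R * (#|X|%:R * #|A|%:R) <= cabs (\sum_t h X t * S t * h Y (- t)).
  by rewrite -key -lecR -cabsE ger0_norm// ler0c !mulr_ge0.
move=> /le_trans -> //; apply: le_trans (cabs_sum _ _ _) _.
apply: le_trans (ler_sum _ (fun t _ => term t)) _.
by rewrite big_split /= -big_mkcond big_pred1_eq -mulr_sumr.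
Qed.
End Sumset.

Fixpoint moment_const (R : realFieldType) (C2 C3 u0 : R) n : R :=
  if n is n'.+1 then 2 * C2 + C3 ^+ 2 * moment_const C2 C3 u0 n' * (1 + u0^-1)
  else 1.

Lemma moment_const_ge0 (R : realFieldType) (C2 C3 u0 : R) n :
  0 < C2 -> 0 < u0 -> 0 < moment_const C2 C3 u0 n.
Proof.
move=> C20 u00; elim: n => //= n IH; apply: ltr_wpDr.
  apply: mulr_ge0; first exact: mulr_ge0 (sqr_ge0 _) (ltW IH).
  by rewrite addr_ge0 ?invr_ge0 ?ltW.
by rewrite mulr_gt0.
Qed.

(** Here [w], [e], [u] stand for [q^(d-1)], [|E|], [|E|^2 / q^(d-1)]. The first term of the
    recurrence is a multiple of [w^(n+1) e u^n], while [q] is inherited from the second moment. The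
    earlier [u^n] is at most [u^(n+1) / u0], whence the factor [1 + u0^-1] in [moment_const]. *)
Lemma moment_recurrence_bound (R : realFieldType) (M : nat -> R)
    (q w e u u0 C2 C3 : R) :
  0 < q -> 0 < w -> 0 < e -> 0 < C2 -> 0 < u0 -> u0 <= u ->
  u * w = e ^+ 2 -> M 2 = q * w * e ->
  (forall n, M n.+1.*2 <= 2 * (C2 * w) * e ^+ n.*2.+1 + C3 ^+ 2 * w * M n.*2) ->
  forall n, M n.+1.*2 <= moment_const C2 C3 u0 n * (w ^+ n.+1 * e * (q + u ^+ n)).
Proof.
move=> q0 w0 e0 C20 u00 u0u uw M2 Mrec; elim=> [|n IH] /=.
  rewrite M2 mul1r expr1 expr0 -subr_ge0.
  have -> : w * e * (q + 1) - q * w * e = w * e by ring.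
  by rewrite mulr_ge0 ?ltW.
set A := moment_const C2 C3 u0 n in IH *.
have A0 : 0 < A by apply: moment_const_ge0.
have u0' : 0 < u := lt_le_trans u00 u0u.
apply: le_trans (Mrec n.+1) _.
have eE : e ^+ n.+1.*2.+1 = e * u ^+ n.+1 * w ^+ n.+1.
  by rewrite exprS -mul2n exprM -uw exprMn mulrA.
have un : u ^+ n <= u0^-1 * u ^+ n.+1.
  by rewrite exprS mulrA ler_peMl ?exprn_ge0 ?(ltW u0')// ler_pdivlMl// mulr1.
have P0 : 0 < w ^+ n.+2 * e by rewrite mulr_gt0 ?exprn_gt0.
apply: le_trans (_ : (w ^+ n.+2 * e) *
  (2 * C2 * u ^+ n.+1 + C3 ^+ 2 * A * (q + u ^+ n)) <= _).
  rewrite mulrDr; apply: lerD.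
    by rewrite eE [w ^+ n.+2]exprS le_eqVlt; apply/orP; left; apply/eqP; ring.
  have -> : w ^+ n.+2 * e * (C3 ^+ 2 * A * (q + u ^+ n)) =
     C3 ^+ 2 * w * (A * (w ^+ n.+1 * e * (q + u ^+ n))) by rewrite [w ^+ n.+2]exprS; ring.
  by rewrite ler_wpM2l// mulr_ge0 ?sqr_ge0 ?ltW.
rewrite [leRHS]mulrCA ler_wpM2l ?(ltW P0)// [leRHS]mulrDl; apply: lerD.
  by apply: ler_wpM2l; [rewrite mulr_ge0 ?ltW | rewrite lerDr ltW].
rewrite -[leRHS]mulrA; apply: ler_wpM2l.
  exact: mulr_ge0 (sqr_ge0 _) (ltW A0).
have uS0 : 0 <= u ^+ n.+1 by rewrite exprn_ge0 ?(ltW u0').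
have iu0 : 0 <= u0^-1 * q by rewrite mulr_ge0 ?invr_ge0 ?ltW.
rewrite mulrDl mul1r mulrDr; lra.
Qed.

(** Each of [q^2], [u^(2i)], [u^(2j)] is [O(x u^k)]: the first by hypothesis, the others because
    [u >= u0] and [x >= 1]. Mixed products follow from the arithmetic-geometric mean. The theorem
    applies this with [k - 1] for [k]. *)
Lemma expr_product_bound (R : realFieldType) (q u u0 c x : R) (k i j : nat) :
  0 < u0 -> u0 <= 1 -> u0 <= u -> 0 < c -> 1 <= x ->
  c * q ^+ 2 <= x * u ^+ k -> (i.*2 <= k)%N -> (j.*2 <= k)%N ->
  (q + u ^+ i) * (q + u ^+ j) <= 2 * (c^-1 + (u0 ^+ k)^-1) * (x * u ^+ k).
Proof.
move=> u00 u01 u0u c0 x1 hq ik jk.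
have u_gt0 : 0 < u := lt_le_trans u00 u0u.
have bnd l : (l.*2 <= k)%N -> (u ^+ l) ^+ 2 <= (u0 ^+ k)^-1 * (x * u ^+ k).
  move=> lk; rewrite -exprM muln2 ler_pdivlMl ?exprn_gt0//.
  apply: le_trans (_ : u ^+ k <= _); last by rewrite ler_peMl ?exprn_ge0 ?(ltW u_gt0).
  rewrite -(subnK lk) !exprD ler_wpM2r ?exprn_ge0 ?(ltW u_gt0)//.
  apply: le_trans (_ : u0 ^+ (k - l.*2) <= _).
    by rewrite ler_piMr ?exprn_ge0 ?(ltW u00)// exprn_ile1 ?(ltW u00).
  by rewrite lerXn2r ?nnegrE ?(ltW u00) ?(ltW u_gt0).
have hq' : q ^+ 2 <= c^-1 * (x * u ^+ k) by rewrite ler_pdivlMl.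
have := bnd i ik; have := bnd j jk.
have -> : 2 * (c^-1 + (u0 ^+ k)^-1) * (x * u ^+ k) =
  2 * (c^-1 * (x * u ^+ k) + (u0 ^+ k)^-1 * (x * u ^+ k)) by rewrite -mulrA [X in 2 * X]mulrDl.
move: (u ^+ i) (u ^+ j) => U V; move: hq'.
move: (c^-1 * _) ((u0 ^+ k)^-1 * _) => G H h1 h2 h3.
have s1 := sqr_ge0 (q - U); have s2 := sqr_ge0 (q - V); have s3 := sqr_ge0 (U - V).
lra.
Qed.

(** With [z = Sm B / (x N)], one has [q <= y + z] and [z^2 <= q (G y)], so [z <= (q + G y) / 2] and
    [q <= (2 + G) y]. *)
Lemma sumset_size_from_char_bound (R : realFieldType) (q x y N G Sm B : R) :
  0 < q -> 0 < x -> 0 < N -> 0 <= y -> 0 <= G ->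
  q * Sm ^+ 2 <= G * (x * N ^+ 2) -> B ^+ 2 <= (q * x) * (q * y) ->
  q * (x * N) <= y * (x * N) + Sm * B ->
  (2 + G)^-1 * q <= y.
Proof.
move=> q0 x0 N0 y0 G0 hS hB h.
have xN : 0 < x * N by rewrite mulr_gt0.
pose z := Sm * B / (x * N).
have hz : q <= y + z.
  by rewrite -(ler_pM2r xN) mulrDl /z divfK// gt_eqF.
have z2 : z ^+ 2 <= q * (G * y).
  rewrite /z expr_div_n ler_pdivrMr ?exprn_gt0// exprMn.
  rewrite -(ler_pM2l q0) [leLHS]mulrA.
  have a1 : 0 <= q * Sm ^+ 2 by apply: mulr_ge0 (ltW q0) (sqr_ge0 _).
  apply: le_trans (ler_pM a1 (sqr_ge0 B) hS hB) _.
  by rewrite le_eqVlt; apply/orP; left; apply/eqP; ring.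
have Gy : 0 <= G * y by rewrite mulr_ge0.
have hz2 : z <= (q + G * y) / 2.
  rewrite leNgt; apply/negP => lt.
  have t0 : 0 <= (q + G * y) / 2 by rewrite divr_ge0// addr_ge0// ltW.
  have : ((q + G * y) / 2) ^+ 2 < z ^+ 2.
    by rewrite ltr_pXn2r ?nnegrE ?(ltW (le_lt_trans t0 lt)).
  move=> /lt_le_trans/(_ z2).
  have : q * (G * y) <= ((q + G * y) / 2) ^+ 2.
    have := sqr_ge0 (q - G * y); move: (G * y) => t s; lra.
  by move=> h1 /(le_lt_trans h1); rewrite ltxx.
rewrite ler_pdivrMl; last by rewrite ltr_wpDr.
move: hz2 hz; rewrite [(2 + G) * y]mulrDl; move: (G * y) => t; lra.
Qed.

(** * From the moments to the sumset *)

Lemma moment_mul_bound (R : realType) (F : finFieldType) (chi : F -> R[i]) d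
    (E : {set 'rV[F]_d}) i j :
  moment chi E (i + j) ^+ 2 <= moment chi E i.*2 * moment chi E j.*2.
Proof.
rewrite /moment; under eq_bigr => m _ do rewrite exprD.
under [X in _ <= X * _]eq_bigr => m _ do rewrite -muln2 exprM.
under [X in _ <= _ * X]eq_bigr => m _ do rewrite -muln2 exprM.
exact: cauchy_schwarz_sum.
Qed.

Lemma regular_variety_transform (R : realType) (F : finFieldType) (d : nat)
    (chi : F -> R[i]) (K : R) (V : {set 'rV[F]_d}) (m : 'rV[F]_d) :
  `|fourier_indicator chi V m| <= K%:C ->
  cabs (\sum_(x in V) chi (- dotv m x)) <= #|F|%:R ^+ d * K.
Proof.
have q0 : 0 < #|F|%:R ^+ d :> R by rewrite exprn_gt0// ltr0n ltnW// finNzRing_gt1.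
rewrite cabsE lecR => h; rewrite -ler_pdivrMl//; apply: le_trans h.
rewrite /fourier_indicator cabsM.
have -> : cabs (#|F|%:R ^- d : R[i]) = (#|F|%:R ^+ d)^-1.
  by apply: complexI; rewrite -cabsE normfV normrX normr_nat fmorphV rmorphXn /= rmorph_nat.
rewrite le_eqVlt; apply/orP; left; apply/eqP; congr (_ * cabs _).
rewrite big_mkcond; apply: eq_bigr => x _.
by case: (x \in V); rewrite ?mulr1 ?mulr0.
Qed.

Lemma balanced_split k : (3 <= k)%N -> exists i j,
  [/\ k = (i.+1 + j.+1)%N, (i.*2 <= k - 1)%N & (j.*2 <= k - 1)%N].
Proof.
move=> hk; exists (k./2).-1, (uphalf k).-1; have := odd_double_half k.
by rewrite uphalf_half; case: (odd k) => /= kk; split; lia.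
Qed.

(* The exponent s is not a power of the characteristic of F: otherwise
   P is the composition of a Frobenius power with a linear form, and the
   conclusion can fail. *)
Theorem theorem1p6 (R : realType) (d k s : nat)
    (hd : (1 <= d)%N) (hk : (3 <= k)%N) (hs : (2 <= s)%N)
    (C1 C2 C3 c : R) (hC1 : 0 < C1) (hC2 : 0 < C2) (hC3 : 0 < C3)
    (hc : 0 < c) :
  exists2 c' : R, 0 < c' &
    forall (F : finFieldType) (chi : F -> R[i]) (a : 'I_d -> F)
      (V E : {set 'rV[F]_d}) (X : {set F}),
      ~~ [pchar F].-nat s ->
      nontrivial_additive_character chi ->
      (forall j, a j != 0) ->
      regular_variety chi C1 C2 C3 V ->
      E \subset V ->
      c * #|F|%:R ^+ ((d - 1) * (k - 1) + 2)
        <= #|X|%:R * #|E|%:R ^+ (2 * k - 2) ->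
      c' * #|F|%:R <= #|sumset X (Delta k (diag_poly s a) E)|%:R.
Proof.
have k1 : k = (k - 1).+1 by clear -hk; lia.
have k2 : (k - 1 = (k - 2).+1)%N by clear -hk; lia.
have k2k : (2 * (k - 1) = 2 * k - 2)%N by clear -hk; lia.
have k2k' : (2 + (2 * k - 2) = k.*2)%N by clear -hk; lia.
have k0 : ((2 * k - 2)%N == 0%N) = false by clear -hk; lia.
pose u0 := Num.min 1 c.
have u00 : 0 < u0 by rewrite lt_min ltr01.
have u01 : u0 <= 1 by rewrite ge_min lexx.
have u0c : u0 <= c by rewrite ge_min lexx orbT.
have [i [j [kE ik jk]]] := balanced_split hk.
pose Ai := moment_const C2 C3 u0 i; pose Aj := moment_const C2 C3 u0 j.
pose Z := 2 * (c^-1 + (u0 ^+ (k - 1))^-1).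
have Ai0 : 0 < Ai by apply: moment_const_ge0.
have Aj0 : 0 < Aj by apply: moment_const_ge0.
have Z0 : 0 < Z by rewrite mulr_gt0// addr_gt0// invr_gt0// exprn_gt0.
(* The constant in [q Sm^2 <= G |X| |E|^(2k)]: [s^(2d)] comes from Weil's bound, the rest from the
   moment of order [k]. *)
pose G := s%:R ^+ d.*2 * (Ai * Aj) * Z.
have G0 : 0 <= G.
  apply: mulr_ge0 (ltW Z0); apply: mulr_ge0; last exact/ltW/mulr_gt0.
  by rewrite exprn_ge0.
exists (2 + G)^-1; first by rewrite invr_gt0 ltr_wpDr.
move=> F chi a V E X sch [[chi0 chiD] chint] a0 [_ /andP[_ hV] hVm] EV.
have q1 : 1 <= #|F|%:R :> R by rewrite ler1n ltnW// finNzRing_gt1.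
have Xq : #|X|%:R <= #|F|%:R :> R by rewrite ler_nat max_card.
set q := (#|F|%:R : R) in q1 Xq hV *; pose w : R := q ^+ (d - 1).
set e := (#|E|%:R : R); set x := (#|X|%:R : R) in Xq *.
have q0 : 0 < q by apply: lt_le_trans q1.
have w0 : 0 < w by rewrite exprn_gt0.
move=> hyp.
have xe0 : 0 < x * e ^+ (2 * k - 2).
  by apply: lt_le_trans hyp; rewrite mulr_gt0 ?exprn_gt0.
have x0 : 0 < x.
  by rewrite lt_neqAle ler0n andbT eq_sym; apply: contraTneq xe0 => ->; rewrite mul0r ltxx.
have e0 : 0 < e.
  rewrite lt_neqAle ler0n andbT eq_sym; apply: contraTneq xe0 => ->.
  by rewrite expr0n k0 mulr0 ltxx.
have x1 : 1 <= x by move: x0; rewrite ltr0n ler1n.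
pose u := e ^+ 2 / w.
have uw : u * w = e ^+ 2 by rewrite divfK// gt_eqF.
have u_gt0 : 0 < u by rewrite divr_gt0// exprn_gt0.
have uwk : u ^+ (k - 1) * w ^+ (k - 1) = e ^+ (2 * k - 2).
  by rewrite -exprMn uw -exprM k2k.
have hyp' : c * q ^+ 2 <= x * u ^+ (k - 1).
  rewrite -(ler_pM2r (exprn_gt0 (k - 1) w0)) -[leRHS]mulrA uwk.
  apply: le_trans hyp; rewrite le_eqVlt; apply/orP; left; apply/eqP.
  by rewrite /w -exprM -mulrA -exprD addnC.
(* If [u < u0 <= 1], then [u^(k-1) <= u], and [|X| <= q] turns the hypothesis into [c q <= u],
   against [u < c]: hence the choice [Num.min 1 c]. *)
have u0u : u0 <= u.
  rewrite leNgt; apply/negP => ltu.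
  have uk : u ^+ (k - 1) <= u.
    rewrite k2 exprSr ler_piMl ?(ltW u_gt0)// exprn_ile1 ?(ltW u_gt0)//.
    exact: ltW (lt_le_trans ltu u01).
  have h1 : c * q ^+ 2 <= q * u by apply: le_trans hyp' _; rewrite ler_pM// ?exprn_ge0 ?ltW.
  have h2 : c * q <= u by rewrite -(ler_pM2l q0); move: h1; rewrite expr2 mulrCA.
  have cu : c <= u by apply: le_trans h2; rewrite ler_peMr ?(ltW hc).
  by have := le_lt_trans cu (lt_le_trans ltu u0c); rewrite ltxx.
pose M n := moment chi E n.
have qdE : q ^+ d = q * w by rewrite /w -exprS subn1 prednK.
have M2 : M 2 = q * w * e by rewrite /M moment2// -qdE.
(* The exponent [(d + 1) / 2] in the regularity of [V] makes [K^2] of order [q^(d-1) = w], the same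
   order as [|V|]. *)
pose K := q ^+ d * (C3 * Num.sqrt q ^- (d + 1)).
have K2 : K ^+ 2 = C3 ^+ 2 * w.
  have sqE : (Num.sqrt q ^- (d + 1)) ^+ 2 = (q * (q * w))^-1.
    by rewrite exprVn -exprM mulnC exprM sqr_sqrtr ?(ltW q0)// addn1 exprS qdE.
  by rewrite /K !exprMn sqE qdE; field; rewrite !gt_eqF.
have Mrec n : M n.+1.*2 <= 2 * (C2 * w) * e ^+ n.*2.+1 + C3 ^+ 2 * w * M n.*2.
  have hK m : m != 0 -> cabs (\sum_(y in V) chi (- dotv m y)) <= K.
    by move=> m0; apply: regular_variety_transform; apply: hVm.
  apply: le_trans (moment_recurrence chi0 chiD chint n EV hK) _.
  rewrite K2 lerD2r ler_wpM2r ?exprn_ge0 ?(ltW e0)// ler_wpM2l//.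
  exact: ltW.
have Mb n := moment_recurrence_bound q0 w0 e0 hC2 u00 u0u uw M2 Mrec n.
have Mk : M k ^+ 2 <= (Ai * Aj) * Z * (x * w * e ^+ k.*2).
  rewrite {1}kE; apply: le_trans (moment_mul_bound chi E i.+1 j.+1) _.
  apply: le_trans (ler_pM (moment_ge0 _ _ _) (moment_ge0 _ _ _) (Mb i) (Mb j)) _.
  have h := expr_product_bound u00 u01 u0u hc x1 hyp' ik jk.
  rewrite -/Z in h.
  have -> : Ai * Aj * Z * (x * w * e ^+ k.*2) =
      Ai * Aj * (w ^+ k * e ^+ 2) * (Z * (x * u ^+ (k - 1))).
    have -> : e ^+ k.*2 = e ^+ 2 * (u ^+ (k - 1) * w ^+ (k - 1)).
      by rewrite uwk -exprD k2k'.
    have -> : w ^+ k = w * w ^+ (k - 1) by rewrite -exprS -k1.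
    ring.
  have -> : moment_const C2 C3 u0 i * (w ^+ i.+1 * e * (q + u ^+ i)) *
     (moment_const C2 C3 u0 j * (w ^+ j.+1 * e * (q + u ^+ j))) =
     Ai * Aj * (w ^+ k * e ^+ 2) * ((q + u ^+ i) * (q + u ^+ j)).
    rewrite [in RHS]kE exprD -/Ai -/Aj; ring.
  apply: ler_wpM2l h; apply: mulr_ge0; apply/ltW; rewrite mulr_gt0 ?exprn_gt0//.
pose Sm := (q ^+ d)^-1 * ((s%:R * Num.sqrt q) ^+ d * M k).
set P := diag_poly s a; set Y := sumset _ _.
pose A := [pred f : {ffun 'I_k -> 'rV[F]_d} | [forall i, f i \in E]].
have cardA : #|A|%:R = e ^+ k :> R.
  rewrite /e -natrX; congr (_%:R).
  have -> : #|A| = #|ffun_on (mem E) : pred {ffun 'I_k -> 'rV[F]_d}|.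
    by apply: eq_card => f; rewrite inE; apply/forallP/ffun_onP.
  by rewrite card_ffun_on card_ord.
have [||B hB hq] := @sumset_char_bound R F chi chi0 chiD chint _ A
    (fun f : {ffun 'I_k -> 'rV[F]_d} => peval P (\sum_i f i)) X Y Sm.
- move=> r f rX Af; apply: imset2_f => //; apply/imsetP; exists f => //.
  by rewrite inE; exact: Af.
- move=> t t0; rewrite ler_pdivlMl ?exprn_gt0//.
  by apply: diag_sumset_char_bound => //; exact: ltnW.
apply: (@sumset_size_from_char_bound R q x _ (e ^+ k) G Sm B) => //.
- by rewrite exprn_gt0.
- have -> : q * Sm ^+ 2 = s%:R ^+ d.*2 * (w^-1 * M k ^+ 2).
    have sqE : (Num.sqrt q ^+ d) ^+ 2 = q * w.
      by rewrite -exprM mulnC exprM sqr_sqrtr ?(ltW q0).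
    rewrite /Sm !exprMn sqE qdE -muln2 exprM; field.
    by rewrite !gt_eqF.
  rewrite -exprM muln2 /G -2!mulrA ler_wpM2l ?exprn_ge0// ler_pdivrMl//.
  by apply: le_trans Mk _; rewrite le_eqVlt; apply/orP; left; apply/eqP; ring.
by move: hq; rewrite cardA.
Qed.
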